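(* Let $M$ be a Riemannian manifold, let $\mu$ be a Borel probability measure on $M$ and $\nu$ a positive Borel measure on $M$. For $q\in(0,1)$ let $$\beta_P:=\sup\Big\{\sum_{k\in\mathbb Z}\frac{[\mu(\Omega_k)]^{1/(1-q)}}{[\mathrm{Cap}_\nu(\Omega_k,\Omega_{k+1})]^{q/(1-q)}}\Big\}^{(1-q)/q},$$ where the supremum is taken over all measurable $\Omega\subset M$ with $\mu(\Omega)\le1/2$ and all sequences $(\Omega_k)_{k\in\mathbb Z}$ of measurable sets such that $\Omega_k\subset\Omega_{k+1}\subset\Omega$ for all $k\in\mathbb Z$. (i) If $q\in[1/2,1)$ and $(\mu,\nu)$ satisfies an $L^q$-Poincaré inequality with constant $C_P$, then $\beta_P\le 2^{1/q}C_P$. (ii) If $q\in(0,1)$ and $\beta_P<+\infty$, then $(\mu,\nu)$ satisfies an $L^q$-Poincaré inequality with a constant $C_P\le\kappa_P\,\beta_P$, for some constant $\kappa_P$ which depends only on $q$.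
   Context: For $q\in(0,1]$, $(\mu,\nu)$ satisfies an $L^q$-Poincaré inequality with constant $C_P$ if for all non-negative $f\in C^1(M)$ $$\big[\mathrm{Var}_\mu(f^q)\big]^{1/q}=\Big[\int f^{2q}d\mu-\Big(\int f^qd\mu\Big)^2\Big]^{1/q}\le C_P\int|\nabla f|^2d\nu.$$ For measurable $A\subset\Omega\subset M$, $\mathrm{Cap}_\nu(A,\Omega):=\inf\{\int|\nabla f|^2d\nu: f\in C^1(M),\ \mathbb 1_A\le f\le\mathbb 1_\Omega\}$, with $\mathrm{Cap}_\nu(A,\Omega):=+\infty$ if there is no such $f$. In the sum, a term with infinite capacity is $0$, a term with $\mu(\Omega_k)>0$ and zero capacity is $+\infty$, and $0/0$ is read as $0$. *)

(* Defs.v *)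
From mathcomp Require Import all_boot all_order all_algebra.
From mathcomp Require Import all_classical all_reals all_analysis.

Set Implicit Arguments.
Unset Strict Implicit.
Unset Printing Implicit Defensive.

Import Order.TTheory GRing.Theory Num.Theory.
Import numFieldNormedType.Exports.

Local Open Scope classical_set_scope.
Local Open Scope ring_scope.

Section Smoothness.
Context {R : realType} {V W : normedModType R}.

(* [U] is meant to be open and [V] finite-dimensional: continuity of all the
   ['D_v f] on [U] is then continuity of the differential on [U]. *)
Fixpoint Ck (k : nat) (U : set V) (f : V -> W) : Prop :=
  match k with
  | 0 => forall x, U x -> {for x, continuous f}
  | k'.+1 => (forall x, U x -> differentiable f x) /\
             forall v, Ck k' U ('D_v f)
  end.

Definition smooth (U : set V) (f : V -> W) : Prop := forall k, Ck k U f.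

End Smoothness.

(* A smooth n-manifold without boundary (Hausdorff, second countable, not
   necessarily connected), presented by an atlas, with a Riemannian metric given
   by its Gram matrices in the charts. [chart_inv i] only matters on the open set
   [chart i @` dom i], and [gram i x] is the matrix of the metric in the
   coordinates of chart [i] at the point with coordinates [x].

   Tangent vectors are row vectors, on which the library's ['J] acts on the
   right; hence the shape of the change of coordinates in [gram_change].

   The carrier is pointed because [g_sigma_algebraType] requires it; a manifold
   carrying a probability measure is nonempty anyway. *)
Record riemannianManifold (R : realType) (n : nat) := RiemannianManifold {
  carrier :> ptopologicalType;
  carrier_hausdorff : hausdorff_space carrier;
  carrier_second_countable : @second_countable carrier;
  index : Type;
  dom : index -> set carrier;
  chart : index -> carrier -> 'rV[R]_n;
  chart_inv : index -> 'rV[R]_n -> carrier;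
  chart_at : carrier -> index;
  dom_chart_at : forall p, dom (chart_at p) p;
  dom_open : forall i, open (dom i);
  image_open : forall i, open (chart i @` dom i);
  chartK : forall i p, dom i p -> chart_inv i (chart i p) = p;
  chart_continuous : forall i p, dom i p -> {for p, continuous (chart i)};
  chart_inv_continuous : forall i x, (chart i @` dom i) x ->
    {for x, continuous (chart_inv i)};
  transition_smooth : forall i j,
    smooth ((chart i @` dom i) `&` (chart_inv i @^-1` dom j))
           (chart j \o chart_inv i);
  gram : index -> 'rV[R]_n -> 'M[R]_n;
  gram_smooth : forall i, smooth (chart i @` dom i) (gram i);
  gram_sym : forall i x, (chart i @` dom i) x -> (gram i x)^T = gram i x;
  gram_posdef : forall i x, (chart i @` dom i) x ->
    forall v : 'rV[R]_n, v != 0 -> 0 < (v *m gram i x *m v^T) 0 0;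
  gram_change : forall i j x, (chart i @` dom i) x -> dom j (chart_inv i x) ->
    let phi := chart j \o chart_inv i in
    gram i x = 'J phi x *m gram j (phi x) *m ('J phi x)^T
}.

Section Gradient.
Context {R : realType} {n : nat} (M : riemannianManifold R n).

Definition C1 (f : M -> R) : Prop :=
  forall i : index M,
    Ck 1 (chart i @` dom i) (f \o chart_inv i : 'rV[R]_n -> R^o).

Definition diff_coord (f : M -> R) (p : M) : 'rV[R]_n :=
  let i := chart_at p in
  \row_k 'D_(delta_mx 0 k) (f \o chart_inv i : 'rV[R]_n -> R^o) (chart i p).

Definition metric_at (p : M) : 'M[R]_n := gram (chart_at p) (chart (chart_at p) p).

(* Coordinates, in the chart [chart_at p], of the vector representing the
   differential of [f] at [p] in the Riemannian inner product. *)
Definition grad (f : M -> R) (p : M) : 'rV[R]_n :=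
  diff_coord f p *m invmx (metric_at p).

Definition grad_norm2 (f : M -> R) (p : M) : R :=
  (grad f p *m metric_at p *m (grad f p)^T) 0 0.

End Gradient.

Notation borel M := (g_sigma_algebraType (@open M)).

Section Poincare.
Context {R : realType} {n : nat} (M : riemannianManifold R n).
Variables (mu : probability (borel M) R) (nu : {measure set (borel M) -> \bar R}).

Definition energy (f : M -> R) : \bar R :=
  (\int[nu]_x (grad_norm2 f (x : M))%:E)%E.

(* - ['V_mu] is [+oo] when [f `^ q] is not square-integrable, and is
     [\int f^(2q) - (\int f^q)^2] otherwise.
   - The inequality is void when its right-hand integral is [+oo], also for
     [C = 0]; the library's [0 * +oo = 0] would say otherwise. *)
Definition Lq_poincare (q C : R) : Prop :=
  0 <= C /\
  forall f : M -> R, C1 f -> (forall x, 0 <= f x) -> (energy f < +oo)%E ->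
    (('V_mu [(fun x : borel M => (f x `^ q)%R)]) `^ q^-1 <= C%:E * energy f)%E.

(* [ereal_inf set0 = +oo] *)
Definition capacity (A Omega : set (borel M)) : \bar R :=
  ereal_inf [set energy f | f in
    [set f : M -> R | C1 f /\ forall x, \1_A x <= f x <= \1_Omega x]].

(* In [\bar R], [0^-1 = +oo], [+oo^-1 = 0] and [0 * +oo = 0], so a term of the
   sum is [0] if the capacity is [+oo], [+oo] if only the capacity vanishes, and
   [0] in the case [0 / 0]. *)
Definition betaP_sum (q : R) (Omega_ : int -> set (borel M)) : \bar R :=
  (\esum_(k in [set: int])
     (mu (Omega_ k) `^ (1 - q)^-1 /
      capacity (Omega_ k) (Omega_ (k + 1)%R) `^ (q / (1 - q))))%E.

Definition betaP (q : R) : \bar R :=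
  ereal_sup [set s : \bar R | exists (Omega : set (borel M))
                                     (Omega_ : int -> set (borel M)),
    [/\ measurable Omega, (mu Omega <= (2^-1)%:E)%E,
        forall k, measurable (Omega_ k),
        forall k, Omega_ k `<=` Omega_ (k + 1) /\ Omega_ (k + 1) `<=` Omega &
        s = (betaP_sum q Omega_ `^ ((1 - q) / q))%E]].

End Poincare.

(* Main.v *)
Require Import Defs.
From mathcomp Require Import all_boot all_order all_algebra.
From mathcomp Require Import all_classical all_reals all_analysis.
From mathcomp Require Import measurable_realfun ring lra.
Import Order.TTheory GRing.Theory Num.Theory.
Import numFieldNormedType.Exports.
Local Open Scope classical_set_scope.
Local Open Scope ring_scope.

Set Implicit Arguments.
Unset Strict Implicit.
Unset Printing Implicit Defensive.

(* (i) Pick almost optimal [f k] for the capacities and test the Poincare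
   inequality on the finite sums [f = \sum_k a k * f k]. The differentials of the
   [f k] have disjoint supports, so the energy of [f] is at most
   [\sum_k a k ^ 2 * Cap_k]; since [2q >= 1], the integral of [f ^ (2q)] is at least
   [\sum_k a k ^ (2q) * mu (Omega_k)]; since [f] vanishes off a set of measure at
   most [1/2], the variance of [f ^ q] is at least half of that integral. Then
   optimise the [a k].

   (ii) Let [m] be a median of [f]. The variance of [f ^ q] is at most the sum of
   the integrals of [(f - m)_+ ^ (2q)] and [(m - f)_+ ^ (2q)]. For [g = f - m] or
   [g = m - f], cut at the dyadic levels: [Omega_k = {g > 2 ^ (-k)}]. Composing [g]
   with a C^1 step between [2 ^ (-k-1)] and [2 ^ (-k)] shows that
   [\sum_k 4 ^ (-k) * Cap_k] is at most [16] times the energy of [f], and Hoelder's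
   inequality bounds [\sum_k 4 ^ (-qk) * mu (Omega_k)], which controls the integral
   of [g_+ ^ (2q)]. *)

(** * Lower integrals *)

(* [grad_norm2] is computed in the arbitrarily chosen charts [chart_at p], so its
   measurability is not at hand. The library's integral of a nonnegative function
   is a supremum over simple minorants even when the function is not measurable;
   this is all that is used about the energy. *)
Section LowerIntegral.
Local Open Scope ereal_scope.
Context d (T : measurableType d) (R : realType).
Variable mu : {measure set T -> \bar R}.
Implicit Types f g : T -> \bar R.

Import HBNNSimple.

Lemma sintegral_le_integral f (h : {nnsfun T >-> R}) :
  (forall x, (h x)%:E <= f x) -> sintegral mu h <= \int[mu]_x f x.
Proof.
move=> hf; rewrite ge0_integralTE => [|x].
  by apply: ereal_sup_ubound; exists h.
by apply: le_trans (hf x); rewrite lee_fin.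
Qed.

Lemma integral_le_sintegral f c : (forall x, 0 <= f x) ->
  (forall h : {nnsfun T >-> R}, (forall x, (h x)%:E <= f x) ->
     sintegral mu h <= c) ->
  \int[mu]_x f x <= c.
Proof.
move=> f0 fc; rewrite ge0_integralTE//.
by apply: ge_ereal_sup => _ [h hf <-]; exact: fc.
Qed.

Lemma le_integralT f g : (forall x, 0 <= f x) -> (forall x, f x <= g x) ->
  \int[mu]_x f x <= \int[mu]_x g x.
Proof.
move=> f0 fg; apply: integral_le_sintegral => // h hf.
by apply: sintegral_le_integral => x; exact: le_trans (hf x) (fg x).
Qed.

(** Dividing a simple minorant of [k * f] by [k] gives a simple minorant of [f]. The reverse
    inequality then follows by rescaling with [k^-1]. *)
Lemma ge0_integralZ_le f (k : R) : (0 < k)%R -> (forall x, 0 <= f x) ->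
  \int[mu]_x (k%:E * f x) <= k%:E * \int[mu]_x f x.
Proof.
move=> k0 f0; apply: integral_le_sintegral => [x|h hf].
  by rewrite mule_ge0// lee_fin ltW.
have kV0 : (0 <= k^-1)%R by rewrite invr_ge0 ltW.
rewrite -(@lee_pmul2l _ k^-1%:E)// ?lte_fin ?invr_gt0//.
rewrite muleA -EFinM mulVf ?gt_eqF// mul1e -sintegralrM.
apply: (@sintegral_le_integral _ (scale_nnsfun h kV0)) => x /=.
rewrite -(@lee_pmul2l _ k%:E)// ?lte_fin//.
by rewrite -EFinM mulrA mulfV ?gt_eqF// mul1r.
Qed.

Lemma ge0_integralZT f (k : R) : (0 <= k)%R -> (forall x, 0 <= f x) ->
  \int[mu]_x (k%:E * f x) = k%:E * \int[mu]_x f x.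
Proof.
rewrite le_eqVlt => /predU1P[<- f0|k0 f0].
  by rewrite mul0e integral0_eq// => x _; rewrite mul0e.
have kn0 : k != 0%R by rewrite gt_eqF.
apply/eqP; rewrite eq_le ge0_integralZ_le//=.
have kf0 x : 0 <= k%:E * f x by rewrite mule_ge0// lee_fin ltW.
have kV0 : (0 < k^-1)%R by rewrite invr_gt0.
rewrite -(@lee_pmul2l _ k^-1%:E)// ?lte_fin// muleA -EFinM mulVf// mul1e.
apply: le_trans (ge0_integralZ_le kV0 kf0).
by apply: le_integralT => // x; rewrite muleA -EFinM mulVf// mul1e.
Qed.

(** Adding simple minorants of [f] and [g] gives one of [f + g]; without measurability only this
    direction can be expected. *)
Lemma integral_superD f g : (forall x, 0 <= f x) -> (forall x, 0 <= g x) ->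
  \int[mu]_x f x + \int[mu]_x g x <= \int[mu]_x (f x + g x).
Proof.
move=> f0 g0.
(* The two suprema are reached one at a time by subtraction, which needs finite values; infinite
   ones are settled by monotonicity. *)
have [gy|] := eqVneq (\int[mu]_x g x) +oo.
  rewrite gy; apply: (le_trans (leey _)); rewrite -gy.
  by apply: le_integralT => // x; rewrite leeDr.
rewrite -ltey => gy.
have gfin : \int[mu]_x g x \is a fin_num by rewrite ge0_fin_numE// integral_ge0.
rewrite -leeBrDr//; apply: integral_le_sintegral => // h hf.
rewrite leeBrDr//.
have h0 : 0 <= sintegral mu h by exact: sintegral_ge0.
have fg0 x : 0 <= f x + g x by rewrite adde_ge0.
have [hy|] := eqVneq (sintegral mu h) +oo.
  rewrite hy addye ?gt_eqF//; last by rewrite ltNye_eq gfin.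
  rewrite -hy; apply: sintegral_le_integral => x.
  by apply: le_trans (hf x) _; rewrite leeDl.
rewrite -ltey => hy.
have hfin : sintegral mu h \is a fin_num by rewrite ge0_fin_numE.
rewrite addeC -leeBrDr//; apply: integral_le_sintegral => // k kg.
rewrite leeBrDr// -sintegralD.
apply: (@sintegral_le_integral _ (add_nnsfun k h)) => x /=.
by rewrite EFinD addeC leeD.
Qed.

Lemma integral_super_sum I (s : seq I) (f : I -> T -> \bar R) :
  (forall i x, 0 <= f i x) ->
  \sum_(i <- s) \int[mu]_x f i x <= \int[mu]_x (\sum_(i <- s) f i x).
Proof.
move=> f0; elim: s => [|i s IH].
  by rewrite big_nil integral_ge0// => x _; rewrite big_nil.
rewrite big_cons.
under [leRHS]eq_integral do rewrite big_cons.
apply: le_trans (integral_superD _ _) => //; first by rewrite leeD.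
by move=> x; rewrite sume_ge0.
Qed.

(** A measurable set separating the supports restores subadditivity: a simple minorant of [f + g] is
    cut along [D] into a minorant of [f] and a minorant of [g]. *)
Lemma integral_disjointD f g (D : set T) : measurable D ->
  (forall x, 0 <= f x) -> (forall x, 0 <= g x) ->
  (forall x, ~ D x -> f x = 0) -> (forall x, D x -> g x = 0) ->
  \int[mu]_x (f x + g x) <= \int[mu]_x f x + \int[mu]_x g x.
Proof.
move=> mD f0 g0 fD gD; apply: integral_le_sintegral => [x|h hfg].
  by rewrite adde_ge0.
have mDC : measurable (~` D) by exact: measurableC.
have projE A (mA : measurable A) x :
    proj_nnsfun h mA x = if x \in A then h x else 0%R.
  by rewrite -mrestrict.
have -> : sintegral mu h =
    sintegral mu (add_nnsfun (proj_nnsfun h mD) (proj_nnsfun h mDC)).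
  apply: eq_sintegral => x.
  change (h x = proj_nnsfun h mD x + proj_nnsfun h mDC x)%R.
  rewrite !projE in_setC.
  by case: (x \in D); rewrite /= ?addr0 ?add0r.
rewrite sintegralD; apply: leeD; apply: sintegral_le_integral => x;
  rewrite projE.
- have [/set_mem Dx|//] := boolP (x \in D).
  by rewrite (le_trans (hfg x))// gD ?adde0.
- have [/set_mem Dx|//] := boolP (x \in ~` D).
  by rewrite (le_trans (hfg x))// fD ?add0e.
Qed.

Lemma integral_disjoint_sum (I : eqType) (s : seq I) (f : I -> T -> \bar R)
    (D : I -> set T) :
  (forall i, measurable (D i)) -> (forall i x, 0 <= f i x) ->
  (forall i x, i \in s -> ~ D i x -> f i x = 0) ->
  (forall i j x, D i x -> D j x -> i = j) -> uniq s ->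
  \int[mu]_x (\sum_(i <- s) f i x) <= \sum_(i <- s) \int[mu]_x f i x.
Proof.
move=> mD f0 + Dij; elim: s => [_ _|i s IH fD /= /andP[iNs us]].
  by rewrite big_nil integral0_eq// => x _; rewrite big_nil.
rewrite big_cons.
under [leLHS]eq_integral do rewrite big_cons.
have {}IH := IH (fun j x js => fD j x (@mem_behead _ (i :: s) j js)) us.
apply: le_trans (leeD (lexx _) IH).
apply: (@integral_disjointD _ _ (D i)) => //.
- by move=> x; rewrite sume_ge0.
- by move=> x; apply: fD; rewrite mem_head.
move=> x Dix; rewrite big_seq big1// => j js; apply: fD.
  by rewrite inE js orbT.
by move=> Djx; move: iNs; rewrite (Dij _ _ _ Dix Djx) js.
Qed.

End LowerIntegral.

(** * C^1 functions and their differentials *)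

Section DifferentialCalculus.
Context {R : realType} {V : normedModType R}.
Implicit Types f g : V -> R^o.

(** For positive increments the difference quotients at a maximum are nonpositive, and the
    derivative is also their one-sided limit. *)
Lemma derive_le0_at_max g (x v : V) : derivable g x v ->
  (forall y, g y <= g x) -> 'D_v g x <= 0.
Proof.
move=> dg gmax.
have cvr : (fun h : R => h^-1 *: ((g \o shift x) (h *: v) - g x)) @ 0^'+ -->
    'D_v g x.
  apply: cvg_trans dg; apply: cvg_app.
  by move=> A [e e0 Ae]; exists e => // h he h0; apply: Ae => //; exact: lt0r_neq0.
rewrite -(cvg_lim _ cvr)//; apply: limr_le; first by apply/cvg_ex; eexists; exact: cvr.
near=> h; apply: mulr_ge0_le0; last by rewrite subr_le0; exact: gmax.
by rewrite invr_ge0; apply: ltW; near: h; exact: nbhs_right_gt.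
Unshelve. all: by end_near. Qed.

Lemma derive_at_max g (x v : V) : differentiable g x ->
  (forall y, g y <= g x) -> 'D_v g x = 0.
Proof.
move=> dg gmax; apply/eqP; rewrite eq_le derive_le0_at_max//=; last exact: diff_derivable.
have := @derive_le0_at_max g x (- v) (@diff_derivable _ _ _ _ _ _ dg) gmax.
by rewrite !deriveE// linearN oppr_le0.
Qed.

Lemma derive_at_min g (x v : V) : differentiable g x ->
  (forall y, g x <= g y) -> 'D_v g x = 0.
Proof.
move=> dg gmin; apply/eqP; rewrite -oppr_eq0; apply/eqP.
rewrite -(deriveN (@diff_derivable _ _ _ _ _ _ dg)); apply: derive_at_max.
  exact: differentiableN.
by move=> y; rewrite lerN2 gmin.
Qed.

Lemma derive_comp (psi dpsi : R -> R) g (x v : V) : differentiable g x ->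
  is_derive (g x) 1 psi (dpsi (g x)) ->
  differentiable (psi \o g : V -> R^o) x /\
  'D_v (psi \o g : V -> R^o) x = dpsi (g x) * 'D_v g x.
Proof.
move=> dg [psi1 psiE].
have dpsix : differentiable (psi : R^o -> R^o) (g x) by exact/derivable1_diffP.
have dc : differentiable (psi \o g : V -> R^o) x by exact: differentiable_comp.
split => //; rewrite !deriveE// diff_comp//= diff1E//.
by rewrite derive1E psiE mulrC.
Qed.

(** As [U] is open, the formula [dg] is valid near each of its points, so its continuity passes to
    the derivative. *)
Lemma Ck1_derive (U : set V) g (dg : V -> V -> R^o) : open U ->
  (forall x, U x -> differentiable g x) ->
  (forall v x, U x -> 'D_v g x = dg v x) ->
  (forall v x, U x -> {for x, continuous (dg v)}) ->
  Ck 1 U g.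
Proof.
move=> oU dfg gE cdg; split => // v x Ux.
rewrite /prop_for /continuous_at/= gE//; apply: cvg_trans (cdg v x Ux).
apply: near_eq_cvg; near=> y; apply/esym/gE.
by near: y; exact: open_nbhs_nbhs.
Unshelve. all: by end_near. Qed.

Lemma Ck1_comp (U : set V) (psi dpsi : R -> R) g : open U ->
  (forall y : R, is_derive y 1 psi (dpsi y)) -> continuous dpsi ->
  Ck 1 U g -> Ck 1 U (psi \o g : V -> R^o).
Proof.
move=> oU dpsiP cdpsi [dg cg].
apply: (@Ck1_derive _ _ (fun v x => dpsi (g x) * 'D_v g x)) => // [x Ux|v x Ux|v x Ux].
- by case: (derive_comp 0 (dg x Ux) (dpsiP _)).
- by case: (derive_comp v (dg x Ux) (dpsiP _)).
apply: cvgM; last exact: cg.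
apply: (@continuous_comp _ R^o R^o g dpsi); last exact: cdpsi.
exact: differentiable_continuous (dg x Ux).
Qed.

Lemma Ck1_addZ (U : set V) f g (a : R) : open U -> Ck 1 U f -> Ck 1 U g ->
  Ck 1 U (a \*: f + g).
Proof.
move=> oU [df cf] [dg cg].
apply: (@Ck1_derive _ _ (fun v x => a * 'D_v f x + 'D_v g x)) => // [x Ux|v x Ux|v x Ux].
- by apply: differentiableD; [apply: differentiableZ; exact: df|exact: dg].
- rewrite deriveD ?deriveZ//.
  + exact/diff_derivable/df.
  + exact/derivableZ/diff_derivable/df.
  + exact/diff_derivable/dg.
apply: cvgD; last exact: cg.
by apply: cvgM; [exact: cvg_cst | exact: cf].
Qed.

End DifferentialCalculus.

(** * Calculus of C^1 functions on the manifold *)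

Section ManifoldCalculus.
Context {R : realType} {n : nat} (M : riemannianManifold R n).
Implicit Types f g : M -> R.

Lemma C1_comp f (psi dpsi : R -> R) :
  (forall y : R, is_derive y 1 psi (dpsi y)) -> continuous dpsi ->
  C1 f -> C1 (psi \o f).
Proof.
by move=> dpsiP cdpsi f1 i; apply: Ck1_comp dpsiP cdpsi (f1 i); exact: image_open.
Qed.

Lemma C1_cst (a : R) : C1 (fun _ : M => a).
Proof.
move=> i; apply: (@Ck1_derive _ _ _ _ (fun _ _ => 0)).
- exact: image_open.
- by move=> x _; exact: differentiable_cst.
- by move=> v x _; exact: derive_cst.
- by move=> v x _; apply: (@cst_continuous 'rV[R]_n R^o).
Qed.

Lemma C1_addZ f g (a : R) : C1 f -> C1 g -> C1 (fun x => a * f x + g x).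
Proof. by move=> f1 g1 i; apply: Ck1_addZ (f1 i) (g1 i); exact: image_open. Qed.

Lemma C1_sum (I : Type) (s : seq I) (a : I -> R) (f : I -> M -> R) :
  (forall i, C1 (f i)) -> C1 (fun x => \sum_(i <- s) a i * f i x).
Proof.
move=> f1; elim: s => [|i s IH].
  by under eq_fun do rewrite big_nil; exact: C1_cst.
by under eq_fun do rewrite big_cons; exact: (C1_addZ (a i) (f1 i) IH).
Qed.

Lemma chart_inv_chart_at (p : M) : chart_inv (chart_at p) (chart (chart_at p) p) = p.
Proof. by apply: chartK; exact: dom_chart_at. Qed.

Lemma C1_differentiable f (p : M) : C1 f ->
  differentiable (f \o chart_inv (chart_at p) : 'rV[R]_n -> R^o) (chart (chart_at p) p).
Proof.
by move=> /(_ (chart_at p))[df _]; apply: df; exists p => //; exact: dom_chart_at.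
Qed.

Lemma diff_coord_comp f (psi dpsi : R -> R) (p : M) : C1 f ->
  is_derive (f p) 1 psi (dpsi (f p)) ->
  diff_coord (psi \o f) p = dpsi (f p) *: diff_coord f p.
Proof.
move=> /(C1_differentiable p) df dpsiP; apply/rowP => k; rewrite !mxE.
have := @derive_comp R 'rV[R]_n psi dpsi (f \o chart_inv (chart_at p)) _ (delta_mx 0 k) df.
by rewrite /= chart_inv_chart_at => /(_ dpsiP)[_ <-].
Qed.

Lemma diff_coord_addZ f g (a : R) (p : M) : C1 f -> C1 g ->
  diff_coord (fun x => a * f x + g x) p = a *: diff_coord f p + diff_coord g p.
Proof.
move=> /(C1_differentiable p) df /(C1_differentiable p) dg.
apply/rowP => k; rewrite !mxE.
rewrite (_ : _ \o _ =
    a \*: (f \o chart_inv (chart_at p) : 'rV[R]_n -> R^o) +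
    (g \o chart_inv (chart_at p) : 'rV[R]_n -> R^o))//.
rewrite deriveD ?deriveZ//; first exact/diff_derivable.
  exact/derivableZ/diff_derivable.
exact/diff_derivable.
Qed.

Lemma diff_coord_cst (a : R) (p : M) : diff_coord (fun _ => a) p = 0.
Proof. by apply/rowP => k; rewrite !mxE; exact: derive_cst. Qed.

Lemma diff_coord_sum (I : Type) (s : seq I) (a : I -> R) (f : I -> M -> R) p :
  (forall i, C1 (f i)) ->
  diff_coord (fun x => \sum_(i <- s) a i * f i x) p =
  \sum_(i <- s) a i *: diff_coord (f i) p.
Proof.
move=> f1; elim: s => [|i s IH].
  by rewrite big_nil; under eq_fun do rewrite big_nil; exact: diff_coord_cst.
rewrite big_cons -IH -diff_coord_addZ//; last exact: C1_sum.
by under eq_fun do rewrite big_cons.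
Qed.

Lemma diff_coord_at_max f (p : M) : C1 f -> (forall x, f x <= f p) ->
  diff_coord f p = 0.
Proof.
move=> /(C1_differentiable p) df fmax; apply/rowP => k; rewrite !mxE.
by apply: derive_at_max => // y /=; rewrite chart_inv_chart_at.
Qed.

Lemma diff_coord_at_min f (p : M) : C1 f -> (forall x, f p <= f x) ->
  diff_coord f p = 0.
Proof.
move=> /(C1_differentiable p) df fmin; apply/rowP => k; rewrite !mxE.
by apply: derive_at_min => // y /=; rewrite chart_inv_chart_at.
Qed.

Lemma grad_norm2_ge0 f (p : M) : 0 <= grad_norm2 f p.
Proof.
rewrite /grad_norm2; have [->|gn0] := eqVneq (grad f p) 0.
  by rewrite !mul0mx mxE.
by apply/ltW/gram_posdef => //; exists p => //; exact: dom_chart_at.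
Qed.

Lemma grad_norm2Z f g (a : R) (p : M) : diff_coord g p = a *: diff_coord f p ->
  grad_norm2 g p = a ^+ 2 * grad_norm2 f p.
Proof.
rewrite /grad_norm2 /grad => ->.
by rewrite -!scalemxAl linearZ/= -!scalemxAr scalerA mxE -expr2.
Qed.

Lemma grad_norm2_eq0 f (p : M) : diff_coord f p = 0 -> grad_norm2 f p = 0.
Proof. by rewrite /grad_norm2 /grad => ->; rewrite !mul0mx mxE. Qed.

(** On the open domain of a chart, [f] is its coordinate expression composed with the chart. *)
Lemma C1_continuous f : C1 f -> continuous f.
Proof.
move=> f1 p; set c := chart_at p; have cp : dom c p := dom_chart_at p.
have cfc : {for p, continuous ((f \o chart_inv c) \o chart c)}.
  apply: continuous_comp; first exact: chart_continuous.
  exact: (@differentiable_continuous _ _ R^o _ _ (C1_differentiable p f1)).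
move: cfc; rewrite /prop_for /continuous_at /= chartK//; apply: cvg_trans.
apply: near_eq_cvg; near=> x; rewrite /= chartK//.
by near: x; apply: open_nbhs_nbhs; split => //; exact: dom_open.
Unshelve. all: by end_near. Qed.

Lemma C1_measurable f : C1 f -> measurable_fun [set: borel M] (f : borel M -> R).
Proof.
move=> /C1_continuous cf.
apply: (measurability _ (RGenOpens.measurableE R)) => _ [_ [a [b ->]] <-].
rewrite setTI; apply: sub_sigma_algebra.
by move/continuousP : cf; apply; exact: interval_open.
Qed.

End ManifoldCalculus.

(** * Energy and increasing families of sets *)

Section Energy.
Context {R : realType} {n : nat} (M : riemannianManifold R n).
Variable nu : {measure set (borel M) -> \bar R}.
Implicit Types f g : M -> R.

Lemma energy_ge0 f : (0 <= energy nu f)%E.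
Proof. by apply: integral_ge0 => x _; rewrite lee_fin grad_norm2_ge0. Qed.

Lemma capacity_ge0 (A Omega : set (borel M)) : (0 <= capacity nu A Omega)%E.
Proof. by apply: le_ereal_inf_tmp => _ [f _ <-]; exact: energy_ge0. Qed.

Lemma int_nondecreasing_subset (T : Type) (O : int -> set T) :
  (forall k, O k `<=` O (k + 1)) -> forall j k, j <= k -> O j `<=` O k.
Proof.
move=> OS j k jk.
have [m ->] : exists m : nat, k = j + m%:Z.
  by exists (absz (k - j)); rewrite gez0_abs ?subr_ge0// addrCA subrr addr0.
elim: m => [|m IH]; first by rewrite addr0.
by apply: (subset_trans IH); rewrite -addn1 PoszD addrA; exact: OS.
Qed.

Lemma annuli_disjoint (T : Type) (O : int -> set T) :
  (forall k, O k `<=` O (k + 1)) ->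
  forall j k x, (O (j + 1) `\` O j) x -> (O (k + 1) `\` O k) x -> j = k.
Proof.
move=> OS j k x [Oj1 Oj] [Ok1 Ok]; apply/eqP; rewrite eq_le !leNgt.
apply/andP; split; apply/negP => lt.
  by apply: Oj; apply: (int_nondecreasing_subset OS) Ok1; rewrite lezD1.
by apply: Ok; apply: (int_nondecreasing_subset OS) Oj1; rewrite lezD1.
Qed.

(* The [f k] are extremal, hence critical, off the annulus [O (k + 1) `\` O k],
   so that the gradients have disjoint supports. *)
Lemma energy_sum (O : int -> set (borel M)) (s : seq int) (a : int -> R)
    (f : int -> M -> R) :
  (forall k, measurable (O k)) -> (forall k, O k `<=` O (k + 1)) ->
  uniq s -> (forall k, C1 (f k)) ->
  (forall k, k \in s -> forall x, \1_(O k) x <= f k x <= \1_(O (k + 1)) x) ->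
  (energy nu (fun x => (\sum_(k <- s) a k * f k x)%R) <=
   \sum_(k <- s) (a k ^+ 2)%:E * energy nu (f k))%E.
Proof.
move=> mO OS us f1 fO; set D := fun k => O (k + 1) `\` O k.
have Ddisj := annuli_disjoint OS.
have df0 k x : k \in s -> ~ D k x -> diff_coord (f k) x = 0.
  move=> ks nDx; have fk01 y : 0 <= f k y <= 1.
    have /andP[fk0 fk1] := fO k ks y.
    by rewrite (le_trans _ fk0) ?(le_trans fk1)// ?indicE ?ler0n// lern1 leq_b1.
  (* On [O k] the value is the global maximum 1; off [O (k + 1)] it is the global minimum 0. *)
  have [Okx|nOkx] := pselect (O k x).
    apply: diff_coord_at_max => // y; have /andP[_ fky] := fk01 y.
    by apply: (le_trans fky); have /andP[+ _] := fO k ks x; rewrite indicE mem_set.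
  apply: diff_coord_at_min => // y; have /andP[fky _] := fk01 y.
  apply: le_trans fky; have /andP[_ +] := fO k ks x.
  by rewrite indicE memNset// => Okx; apply: nDx.
have -> : (\sum_(k <- s) (a k ^+ 2)%:E * energy nu (f k) =
    \sum_(k <- s) \int[nu]_x ((a k ^+ 2)%:E * (grad_norm2 (f k) (x : M))%:E))%E.
  apply: eq_bigr => k _; rewrite ge0_integralZT// ?sqr_ge0// => x.
  by rewrite lee_fin grad_norm2_ge0.
have g0 k (x : M) : (0 <= (a k ^+ 2)%:E * (grad_norm2 (f k) x)%:E)%E.
  by rewrite -EFinM lee_fin mulr_ge0 ?sqr_ge0 ?grad_norm2_ge0.
apply: le_trans (@integral_disjoint_sum _ _ _ nu _ s _ D _ g0 _ Ddisj us); last 2 first.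
- by move=> k; exact: measurableD.
- by move=> k x ks Dkx; rewrite grad_norm2_eq0 ?mule0//; exact: df0.
apply: le_integralT => x; first by rewrite lee_fin grad_norm2_ge0.
(* In the annulus of index [k] the differential of the sum is [a k] times that of [f k]; outside all
   the annuli it vanishes. *)
have [[k ks Dkx]|nD] := pselect (exists2 k, k \in s & D k x); last first.
  rewrite grad_norm2_eq0; first by rewrite sume_ge0.
  rewrite diff_coord_sum// big_seq big1// => k ks.
  by rewrite df0 ?scaler0// => Dkx; apply: nD; exists k.
rewrite (@grad_norm2Z _ _ _ (f k) _ (a k)).
  rewrite (bigD1_seq k)//= EFinM leeDl// sume_ge0//.
rewrite diff_coord_sum// (bigD1_seq k)//= big_seq_cond big1 ?addr0// => j.
move=> /andP[js jk]; rewrite df0 ?scaler0// => Djx.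
by move: jk; rewrite (Ddisj _ _ _ Djx Dkx) eqxx.
Qed.

End Energy.

(** * Powers and variance *)

Section RealPowers.
Context {R : realType}.
Implicit Types (a b x y p q : R).

(** The ratios [a / (a + b)] and [b / (a + b)] add up to 1, and on the unit interval a power
    [q <= 1] dominates the identity. *)
Lemma powR_subadditive q a b : 0 < q -> q <= 1 -> 0 <= a -> 0 <= b ->
  (a + b) `^ q <= a `^ q + b `^ q.
Proof.
move=> q0 q1 a0 b0; have [->|a_neq0] := eqVneq a 0.
  by rewrite add0r powR0 ?gt_eqF// add0r.
have [->|b_neq0] := eqVneq b 0.
  by rewrite addr0 [0 `^ q]powR0 ?gt_eqF// addr0.
have agt : 0 < a by rewrite lt_def a_neq0.
have bgt : 0 < b by rewrite lt_def b_neq0.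
have s0 : 0 < a + b by rewrite addr_gt0.
have H c : 0 < c -> c <= a + b -> (a + b) `^ q * (c / (a + b)) <= c `^ q.
  move=> c0 cs; rewrite -[in leRHS](@divfK _ (a + b) _ c) ?gt_eqF//.
  rewrite powRM ?divr_ge0 ?(ltW c0) ?(ltW s0)// mulrC ler_wpM2r ?powR_ge0//.
  by apply: ger1_powR => //; rewrite divr_gt0//= ler_pdivrMr// mul1r.
apply: le_trans (lerD (H a agt _) (H b bgt _)); rewrite ?lerDl ?lerDr//.
by rewrite -mulrDr -mulrDl divff ?gt_eqF// mulr1.
Qed.

(** Same normalisation: on the unit interval a power [p >= 1] lies below the identity. *)
Lemma powR_superadditive p a b : 1 <= p -> 0 <= a -> 0 <= b ->
  a `^ p + b `^ p <= (a + b) `^ p.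
Proof.
move=> p1 a0 b0; have p0 : 0 < p by exact: lt_le_trans p1.
have [->|a_neq0] := eqVneq a 0.
  by rewrite [0 `^ p]powR0 ?gt_eqF// !add0r.
have [->|b_neq0] := eqVneq b 0.
  by rewrite [0 `^ p]powR0 ?gt_eqF// !addr0.
have agt : 0 < a by rewrite lt_def a_neq0.
have bgt : 0 < b by rewrite lt_def b_neq0.
have s0 : 0 < a + b by rewrite addr_gt0.
have H c : 0 < c -> c <= a + b -> c `^ p <= (a + b) `^ p * (c / (a + b)).
  move=> c0 cs; rewrite -[in leLHS](@divfK _ (a + b) _ c) ?gt_eqF//.
  rewrite powRM ?divr_ge0 ?(ltW c0) ?(ltW s0)// mulrC ler_wpM2l ?powR_ge0//.
  by apply: ge1r_powR => //; rewrite divr_gt0//= ler_pdivrMr// mul1r.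
apply: le_trans (lerD (H a agt _) (H b bgt _)) _; rewrite ?lerDl ?lerDr//.
by rewrite -mulrDr -mulrDl divff ?gt_eqF// mulr1.
Qed.

Lemma powR_superadditive_sum (I : Type) (s : seq I) (F : I -> R) p : 1 <= p ->
  (forall i, 0 <= F i) -> \sum_(i <- s) F i `^ p <= (\sum_(i <- s) F i) `^ p.
Proof.
move=> p1 F0; elim: s => [|i s IH]; first by rewrite !big_nil powR_ge0.
rewrite !big_cons; apply: le_trans (powR_superadditive p1 _ _) => //.
  by rewrite lerD2l.
exact: sumr_ge0.
Qed.

(** By symmetry [x <= y], so the first positive part vanishes, and subadditivity gives
    [y ^ q - x ^ q <= (y - x) ^ q]. *)
Lemma sqr_powRB_le q x y : 0 < q -> q <= 1 -> 0 <= x -> 0 <= y ->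
  (x `^ q - y `^ q) ^+ 2 <=
  Num.max (x - y) 0 `^ (2 * q) + Num.max (y - x) 0 `^ (2 * q).
Proof.
move=> q0 q1; wlog xy : x y / x <= y => [H|x0 y0].
  have [xy|/ltW yx x0 y0] := leP x y; first exact: H.
  by rewrite -opprB sqrrN [leRHS]addrC; exact: H.
rewrite [Num.max (x - y) 0]max_r ?subr_le0// powR0; last by rewrite gt_eqF ?mulr_gt0.
rewrite add0r max_l ?subr_ge0// mulrC powRrM -[2]/(2%:R) powR_mulrn ?powR_ge0//.
have xyq : x `^ q <= y `^ q by apply: ge0_ler_powR; rewrite ?nnegrE// ltW.
have le_q : y `^ q - x `^ q <= (y - x) `^ q.
  by rewrite lerBlDr -[in leLHS](subrK x y) powR_subadditive ?subr_ge0.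
by rewrite -opprB sqrrN ler_sqr// nnegrE ?powR_ge0// subr_ge0.
Qed.

(** Divide by [S ^ q] and take the power [1 / q]. The constant of part (i) arises here, from the
    factor 2 in the variance bound. *)
Lemma powR_le_of_le_powRM q (S C : R) : 0 < q -> q < 1 -> 0 <= S -> 0 <= C ->
  S <= 2 * (C * S) `^ q -> S `^ ((1 - q) / q) <= 2 `^ q^-1 * C.
Proof.
move=> q0 q1 S0 C0 SC; have q10 : 0 < 1 - q by rewrite subr_gt0.
have [->|S_neq0] := eqVneq S 0.
  by rewrite powR0 ?gt_eqF ?divr_gt0// mulr_ge0 ?powR_ge0.
have Sgt : 0 < S by rewrite lt_def S_neq0.
have : S `^ (1 - q) <= 2 * C `^ q.
  rewrite -(ler_pM2r (powR_gt0 q Sgt)) -powRD ?subrK ?oner_eq0// powRr1//.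
  by rewrite -mulrA -powRM.
move=> SC1; rewrite powRrM.
have qV0 : 0 <= q^-1 by rewrite invr_ge0 ltW.
apply: le_trans (ge0_ler_powR qV0 _ _ SC1) _; rewrite ?nnegrE ?powR_ge0//.
  by rewrite mulr_ge0 ?powR_ge0.
by rewrite powRM ?powR_ge0// -powRrM divff ?gt_eqF// powRr1.
Qed.

(** Young's inequality for [x ^ q] and [y ^ (1 - q)] with the conjugate exponents [1 / q] and
    [1 / (1 - q)]. *)
Lemma weighted_AMGM q x y : 0 < q -> q < 1 -> 0 <= x -> 0 <= y ->
  x `^ q * y `^ (1 - q) <= q * x + (1 - q) * y.
Proof.
move=> q0 q1 x0 y0; have q10 : 0 < 1 - q by rewrite subr_gt0.
have := @conjugate_powR R (x `^ q) (y `^ (1 - q)) q^-1 (1 - q)^-1.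
rewrite !invrK -!powRrM !divff ?gt_eqF// !powRr1// [x * q]mulrC [y * _]mulrC.
by apply; rewrite ?powR_ge0 ?invr_gt0// addrC subrK.
Qed.

(** Normalise by [A] and [B] and add up the weighted means. If [A] or [B] is 0, every term on the
    left vanishes. *)
Lemma finite_hoelder (I : eqType) (s : seq I) (a b : I -> R) (A B q : R) :
  0 < q -> q < 1 -> (forall i, 0 <= a i) -> (forall i, 0 <= b i) ->
  \sum_(i <- s) a i <= A -> \sum_(i <- s) b i <= B ->
  \sum_(i <- s) a i `^ q * b i `^ (1 - q) <= A `^ q * B `^ (1 - q).
Proof.
move=> q0 q1 a0 b0 aA bB; have q10 : 0 < 1 - q by rewrite subr_gt0.
have A0 : 0 <= A by apply: le_trans aA; exact: sumr_ge0.
have B0 : 0 <= B by apply: le_trans bB; exact: sumr_ge0.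
have sum0 (c : I -> R) r : 0 < r -> (forall i, 0 <= c i) ->
    \sum_(i <- s) c i <= 0 -> all (fun i => c i `^ r == 0) s.
  move=> r0 c0 csum; have : \sum_(i <- s) c i == 0.
    by rewrite eq_le csum sumr_ge0.
  rewrite psumr_eq0//; apply: sub_all => i /= /eqP ->.
  by rewrite powR0 ?eqxx// gt_eqF.
have le0 : all (fun i => a i `^ q * b i `^ (1 - q) == 0) s ->
    \sum_(i <- s) a i `^ q * b i `^ (1 - q) <= A `^ q * B `^ (1 - q).
  move=> /allP s0; rewrite big_seq big1 ?mulr_ge0 ?powR_ge0// => i /s0 /eqP//.
have [A_eq0|A_neq0] := eqVneq A 0.
  apply: le0; rewrite A_eq0 in aA; apply: sub_all (sum0 _ _ q0 a0 aA) => i /= /eqP ->.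
  by rewrite mul0r.
have [B_eq0|B_neq0] := eqVneq B 0.
  apply: le0; rewrite B_eq0 in bB; apply: sub_all (sum0 _ _ q10 b0 bB) => i /= /eqP ->.
  by rewrite mulr0.
have Agt : 0 < A by rewrite lt_def A_neq0.
have Bgt : 0 < B by rewrite lt_def B_neq0.
have -> : \sum_(i <- s) a i `^ q * b i `^ (1 - q) = A `^ q * B `^ (1 - q) *
    \sum_(i <- s) (a i / A) `^ q * (b i / B) `^ (1 - q).
  rewrite mulr_sumr; apply: eq_bigr => i _.
  rewrite -[in LHS](divfK A_neq0 (a i)) -[in LHS](divfK B_neq0 (b i)).
  rewrite (@powRM _ _ A) ?divr_ge0// (@powRM _ _ B) ?divr_ge0//.
  by rewrite mulrACA mulrC.
rewrite ler_piMr ?mulr_ge0 ?powR_ge0//.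
apply: (@le_trans _ _ (\sum_(i <- s) (q * (a i / A) + (1 - q) * (b i / B)))).
  by apply: ler_sum => i _; apply: weighted_AMGM => //; rewrite divr_ge0.
rewrite big_split/= -!mulr_sumr -!mulr_suml -[leRHS](subrK q) addrC lerD//.
  by rewrite ler_piMr ?(ltW q10)// ler_pdivrMr// mul1r.
by rewrite ler_piMr ?(ltW q0)// ler_pdivrMr// mul1r.
Qed.

End RealPowers.

(** * Two-sided bounds for the variance *)

Section Variance.
Local Open Scope ereal_scope.
Context d (T : measurableType d) (R : realType) (P : probability T R).
Implicit Type X : T -> R.

Lemma fineK_probability (A : set T) : measurable A -> (fine (P A))%:E = P A.
Proof. by move=> mA; rewrite fineK// fin_num_measure. Qed.

(** No integrability is assumed: the variance is by definition centred at the [fine] part of the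
    expectation, whatever its value. *)
Lemma variance_integralE X :
  'V_P[X] = \int[P]_x ((X x - fine 'E_P[X]) ^+ 2)%:E.
Proof.
rewrite /variance covariance.unlock; set m := fine _.
by rewrite unlock; apply: eq_integral => x _ /=; rewrite expr2.
Qed.

(* On [Omega], [X^2 / 2 <= (X - m)^2 + m^2]; since [Omega] has measure at most
   [1/2], the term [m^2] is absorbed by [(X - m)^2 = m^2] off [Omega]. *)
Lemma variance_ge_half X (Omega : set T) : measurable_fun setT X ->
  measurable Omega -> P Omega <= (2^-1)%:E ->
  (forall x, ~ Omega x -> X x = 0%R) ->
  2^-1%:E * \int[P]_x (X x ^+ 2)%:E <= 'V_P[X].
Proof.
move=> mX mO PO XO; rewrite variance_integralE; set m := fine _.
have mOC : measurable (~` Omega) by exact: measurableC.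
have POC : P Omega <= P (~` Omega).
  rewrite probability_setC//; move: PO; rewrite -(@fineK _ (P Omega)) ?fin_num_measure//.
  by rewrite -EFinB !lee_fin; lra.
have mD : measurable_fun setT (fun x => (X x - m) ^+ 2)%R.
  by apply: measurable_funX; exact: measurable_funB.
have m1 (A : set T) : measurable A -> measurable_fun setT (fun x => m ^+ 2 * \1_A x)%R.
  by move=> mA; apply: measurable_funM => //; exact: measurable_indic.
have mDO : measurable_fun setT (fun x => (X x - m) ^+ 2 * \1_Omega x)%R.
  by apply: measurable_funM => //; exact: measurable_indic.
have int1 (A : set T) : measurable A -> \int[P]_x (m ^+ 2 * \1_A x)%:E = (m ^+ 2)%:E * P A.
  move=> mA; under eq_integral do rewrite EFinM.
  rewrite ge0_integralZT ?sqr_ge0//.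
  by rewrite integral_indic// setIT.
rewrite -ge0_integralZT ?invr_ge0//; last by move=> x; rewrite lee_fin sqr_ge0.
apply: (@le_trans _ _
    (\int[P]_x (((X x - m) ^+ 2 * \1_Omega x)%:E + (m ^+ 2 * \1_Omega x)%:E))).
  apply: le_integralT => x; first by rewrite -EFinM lee_fin mulr_ge0 ?sqr_ge0.
  rewrite -EFinM -EFinD lee_fin indicE.
  have [_|/negP xO] := boolP (x \in Omega); first rewrite !mulr1.
    (* Twice the difference of the two sides is [(X x - 2 * m) ^ 2]. *)
    by have := sqr_ge0 (X x - 2 * m)%R; lra.
  by rewrite XO ?expr0n ?mulr0 ?addr0// => Ox; apply: xO; rewrite inE.
rewrite ge0_integralD//; last 4 first.
- by move=> x _; rewrite lee_fin mulr_ge0 ?sqr_ge0.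
- exact/measurable_EFinP.
- by move=> x _; rewrite lee_fin mulr_ge0 ?sqr_ge0.
- exact/measurable_EFinP/m1.
rewrite int1//; apply: (@le_trans _ _
    (\int[P]_x ((X x - m) ^+ 2 * \1_Omega x)%:E + (m ^+ 2)%:E * P (~` Omega))).
  by rewrite leeD2l// lee_wpmul2l// lee_fin sqr_ge0.
rewrite -int1// -ge0_integralD//; last 4 first.
- by move=> x _; rewrite lee_fin mulr_ge0 ?sqr_ge0.
- exact/measurable_EFinP.
- by move=> x _; rewrite lee_fin mulr_ge0 ?sqr_ge0.
- exact/measurable_EFinP/m1.
apply: le_integralT => x; first by rewrite -EFinD lee_fin addr_ge0// mulr_ge0 ?sqr_ge0.
rewrite -EFinD lee_fin !indicE in_setC.
have [_|/negP xO] := boolP (x \in Omega); first by rewrite /= mulr1 mulr0 addr0.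
rewrite /= mulr0 add0r mulr1 XO ?sub0r ?sqrrN//.
by move=> Ox; apply: xO; rewrite inE.
Qed.

Lemma sqr_integrable_Lfun2 X : measurable_fun setT X ->
  \int[P]_x (X x ^+ 2)%:E < +oo -> X \in Lfun P 2%:E.
Proof.
move=> mX X2; rewrite inE/=; apply/andP; split; rewrite inE//=.
rewrite /finite_norm unlock /Lnorm poweR_lty//.
apply: le_lt_trans X2; apply: le_integralT => x; first exact: poweR_ge0.
by rewrite poweR_EFin lee_fin -[2%R]/(2%:R) powR_mulrn// real_normK ?num_real.
Qed.

(** Translate by [c] and drop the squared expectation of [X - c]. A finite right-hand side puts
    [X - c] in L^2, which justifies this; an infinite one leaves nothing to prove. *)
Lemma variance_le_sqr X (c : R) : measurable_fun setT X ->
  'V_P[X] <= \int[P]_x ((X x - c) ^+ 2)%:E.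
Proof.
move=> mX; have [->|] := eqVneq (\int[P]_x ((X x - c) ^+ 2)%:E) +oo.
  exact: leey.
rewrite -ltey => fin2.
have mXc : measurable_fun setT (X \- cst c)%R by exact: measurable_funB.
have Xc2 : (X \- cst c)%R \in Lfun P 2%:E by exact: sqr_integrable_Lfun2.
have -> : X = ((X \- cst c) \+ cst c)%R by apply/funext => x /=; rewrite subrK.
rewrite varianceD_cst_r// varianceE// [leRHS](_ : _ = 'E_P[(X \- cst c) ^+ 2]).
  rewrite leeBlDr ?leeDl ?sqre_ge0// fin_numX// expectation_fin_num//.
  by rewrite Lfun_subset12// fin_num_measure.
by rewrite unlock; apply: eq_integral => x _ /=; rewrite addrK.
Qed.

End Variance.

(** * From the Poincare inequality to capacities *)

Section PoincareToCapacity.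
Context {R : realType} {n : nat} (M : riemannianManifold R n).
Variables (mu : probability (borel M) R) (nu : {measure set (borel M) -> \bar R}).
Variables (q C : R) (Omega : set (borel M)) (O : int -> set (borel M)).
Hypothesis q_gt0 : 0 < q.
Hypothesis q_lt1 : q < 1.
Hypothesis q_ge_half : 2^-1 <= q.
Hypothesis poinc : Lq_poincare mu nu q C.
Hypothesis mOmega : measurable Omega.
Hypothesis muOmega : (mu Omega <= (2^-1)%:E)%E.
Hypothesis mO : forall k, measurable (O k).
Hypothesis OS : forall k, O k `<=` O (k + 1).
Hypothesis OOmega : forall k, O k `<=` Omega.

Let m k : R := fine (mu (O k)).

(** The bounds [e k] are real, so the test function [F] has finite energy, as [Lq_poincare]
    requires. *)
Lemma poincare_test_sum (s : seq int) (a e : int -> R) (f : int -> M -> R) :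
  uniq s -> (forall k, 0 <= a k) -> (forall k, C1 (f k)) ->
  (forall k, k \in s -> forall x, \1_(O k) x <= f k x <= \1_(O (k + 1)) x) ->
  (forall k, k \in s -> (energy nu (f k) <= (e k)%:E)%E) ->
  \sum_(k <- s) a k `^ (2 * q) * m k <=
  2 * (C * \sum_(k <- s) a k ^+ 2 * e k) `^ q.
Proof.
move=> us a0 f1 fO fe; have [C0 poincC] := poinc.
have fge0 k x : k \in s -> 0 <= f k x.
  by move=> ks; have /andP[+ _] := fO k ks x; apply: le_trans; rewrite indicE ler0n.
pose F x := \sum_(k <- s) a k * f k x.
have F1 : C1 F by exact: C1_sum.
have F0 x : 0 <= F x.
  by rewrite /F big_seq sumr_ge0// => k ks; rewrite mulr_ge0// fge0.
set E := \sum_(k <- s) a k ^+ 2 * e k.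
have FE : (energy nu F <= E%:E)%E.
  apply: le_trans (energy_sum nu a mO OS us f1 fO) _.
  rewrite /E -sumEFin big_seq [leRHS]big_seq; apply: lee_sum => k ks.
  by rewrite [leRHS]EFinM lee_wpmul2l ?lee_fin ?sqr_ge0// fe.
have Foo : (energy nu F < +oo)%E by apply: le_lt_trans FE _; rewrite ltry.
pose X (x : borel M) : R := F x `^ q.
have mX : measurable_fun [set: borel M] X.
  exact: measurableT_comp (measurable_powR _) (C1_measurable F1).
have XOmega x : ~ Omega x -> X x = 0.
  move=> nOx; rewrite /X /F big_seq big1 ?powR0 ?gt_eqF// => k ks.
  have /andP[_ +] := fO k ks x; rewrite indicE memNset => [fk0|/OOmega//].
  suff -> : f k x = 0 by rewrite mulr0.
  by apply/eqP; rewrite eq_le fk0 fge0.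
have half := variance_ge_half mX mOmega muOmega XOmega.
have CE0 : 0 <= C * E.
  rewrite mulr_ge0// /E big_seq sumr_ge0// => k ks; rewrite mulr_ge0 ?sqr_ge0//.
  by rewrite -lee_fin; apply: le_trans (fe k ks); exact: energy_ge0.
have VC : ('V_mu[X] <= ((C * E) `^ q)%:E)%E.
  have -> : 'V_mu[X] = (('V_mu[X] `^ q^-1) `^ q)%E.
    by rewrite -poweRrM mulVf ?gt_eqF// poweRe1// variance_ge0.
  rewrite -poweR_EFin; apply: gt0_ler_poweR; first exact: ltW.
  - by rewrite in_itv/= poweR_ge0 leey.
  - by rewrite in_itv/= lee_fin CE0 leey.
  apply: le_trans (poincC _ F1 F0 Foo) _.
  by rewrite EFinM lee_wpmul2l ?lee_fin.
have sumX : ((\sum_(k <- s) a k `^ (2 * q) * m k)%:E <=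
    \int[mu]_x (X x ^+ 2)%:E)%E.
  apply: (@le_trans _ _
      (\int[mu]_x (\sum_(k <- s) (a k `^ (2 * q) * \1_(O k) x)%:E))%E).
    apply: le_trans (integral_super_sum _ _ _); last first.
      by move=> k x; rewrite lee_fin mulr_ge0 ?powR_ge0.
    rewrite -sumEFin; apply: lee_sum => k _; under eq_integral do rewrite EFinM.
    rewrite ge0_integralZT ?powR_ge0//.
    by rewrite integral_indic// setIT EFinM fineK_probability.
  apply: le_integralT => x.
    by apply: sume_ge0 => k _; rewrite lee_fin mulr_ge0 ?powR_ge0.
  rewrite sumEFin lee_fin -powR_mulrn ?powR_ge0// -powRrM [q * _]mulrC.
  apply: (@le_trans _ _ ((\sum_(k <- s) a k * \1_(O k) x) `^ (2 * q))); last first.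
    apply: ge0_ler_powR; rewrite ?nnegrE ?mulr_ge0 ?(ltW q_gt0)//.
      by rewrite sumr_ge0// => k _; rewrite mulr_ge0.
    rewrite /F big_seq [leRHS]big_seq; apply: ler_sum => k ks.
    by rewrite ler_wpM2l//; have /andP[] := fO k ks x.
  (* Here [q >= 1/2] enters: the power [2 * q >= 1] is superadditive. *)
  apply: le_trans (powR_superadditive_sum _ _ _); last 2 first.
  - by rewrite -ler_pdivrMl// mulr1.
  - by move=> k; rewrite mulr_ge0.
  apply: ler_sum => k _; rewrite powRM// ler_wpM2l ?powR_ge0// indicE.
  by case: (_ \in _); rewrite ?powR1 ?powR_ge0.
have : ((2^-1 * \sum_(k <- s) a k `^ (2 * q) * m k)%:E <= ((C * E) `^ q)%:E)%E.
  apply: le_trans VC; apply: le_trans half.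
  by rewrite EFinM lee_wpmul2l// lee_fin.
by rewrite lee_fin ler_pdivrMl.
Qed.

(* The weights [a k] of the test function [\sum_k a k * f k] equalise
   [a k ^ (2q) * mu (O k)] and [a k ^ 2 * e k]: both are the [k]-th summand of
   [betaP_sum], with [e k] in place of the capacity. *)
Lemma poincare_capacity_finite (s : seq int) (e : int -> R) :
  uniq s -> (forall k, 0 < e k) ->
  (forall k, k \in s -> (capacity nu (O k) (O (k + 1)%R) < (e k)%:E)%E) ->
  (\sum_(k <- s) m k `^ (1 - q)^-1 / e k `^ (q / (1 - q))) `^ ((1 - q) / q) <=
  2 `^ q^-1 * C.
Proof.
move=> us e0 ecap; have q10 : 0 < 1 - q by rewrite subr_gt0.
have C0 : 0 <= C by case: poinc.
have m0 k : 0 <= m k by rewrite fine_ge0.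
(* Outside [s] the zero function is taken, so that every [f k] is C^1. *)
have /choice[f fP] : forall k, exists f : M -> R, C1 f /\ (k \in s ->
    (forall x, \1_(O k) x <= f x <= \1_(O (k + 1)) x) /\
    (energy nu f <= (e k)%:E)%E).
  move=> k; have [ks|_] := boolP (k \in s).
    have [_ [f [f1 fO] <-] /ltW fe] := ereal_inf_lt (ecap k ks).
    by exists f; split.
  by exists (fun=> 0); split => //; exact: C1_cst.
(* Solving [a k ^ (2q) * m k = a k ^ 2 * e k] for [a k] gives the exponent [1 / (2 (1 - q))] of
   [m k / e k]. *)
pose r := (2 * (1 - q))^-1; have r0 : r != 0 by rewrite invr_neq0// mulf_neq0 ?gt_eqF.
pose a k := (m k / e k) `^ r.
pose b k := m k `^ (1 - q)^-1 / e k `^ (q / (1 - q)).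
have aE k : a k `^ (2 * q) * m k = b k.
  rewrite /a /b -powRrM.
  have -> : r * (2 * q) = q / (1 - q).
    by rewrite /r; field; rewrite gt_eqF.
  have [->|mk0] := eqVneq (m k) 0.
    by rewrite mulr0 powR0 ?mul0r// invr_neq0// gt_eqF.
  rewrite powRM ?invr_ge0 ?(ltW (e0 k))// mulrAC -{2}(powRr1 (m0 k)) -powRD ?mk0 ?implybT//.
  have -> : q / (1 - q) + 1 = (1 - q)^-1 by field; rewrite gt_eqF.
  by rewrite -(powR_inv1 (ltW (e0 k))) -powRrM mulN1r powRN.
have aE2 k : a k ^+ 2 * e k = b k.
  rewrite /a /b -powR_mulrn ?powR_ge0// -powRrM.
  have -> : r * 2%:R = (1 - q)^-1.
    by rewrite /r; field; rewrite gt_eqF.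
  rewrite powRM ?invr_ge0 ?(ltW (e0 k))// -mulrA; congr (_ * _).
  transitivity ((e k)^-1 `^ (1 + q / (1 - q)) * e k).
    by congr (_ `^ _ * _); field; rewrite gt_eqF.
  rewrite powRD; last by rewrite invr_eq0 [e k == 0]gt_eqF// implybT.
  rewrite powRr1 ?invr_ge0 ?(ltW (e0 k))// mulrAC mulVf ?mul1r ?gt_eqF//.
  by rewrite -(powR_inv1 (ltW (e0 k))) -powRrM mulN1r powRN.
(* With [S] the sum of the [b k], the test inequality reads [S <= 2 * (C * S) ^ q]. *)
apply: powR_le_of_le_powRM => //.
  by apply: sumr_ge0 => k _; rewrite divr_ge0 ?powR_ge0.
have := @poincare_test_sum s a e f us (fun k => powR_ge0 _ _) (fun k => (fP k).1)
  (fun k ks => ((fP k).2 ks).1) (fun k ks => ((fP k).2 ks).2).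
by rewrite (eq_bigr b (fun k _ => aE k)) (eq_bigr b (fun k _ => aE2 k)).
Qed.

Lemma poincare_betaP_sum : (betaP_sum mu nu q O `^ ((1 - q) / q) <=
  (2 `^ q^-1 * C)%:E)%E.
Proof.
have q10 : 0 < 1 - q by rewrite subr_gt0.
have C0 : 0 <= C by case: poinc.
have m0 k : 0 <= m k by rewrite fine_ge0.
set p := (1 - q)^-1; set r := q / (1 - q).
have r0 : 0 < r by rewrite divr_gt0.
have rV : (1 - q) / q = r^-1 by rewrite invf_div.
pose cap k := capacity nu (O k) (O (k + 1)).
have cap0 k : (0 <= cap k)%E by exact: capacity_ge0.
set B := (2 `^ q^-1 * C) `^ r.
have finite_bound (s : seq int) (e : int -> R) : uniq s -> (forall k, 0 < e k) ->
    (forall k, k \in s -> (cap k < (e k)%:E)%E) ->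
    \sum_(k <- s) m k `^ p / e k `^ r <= B.
  move=> us e0 ecap; have := poincare_capacity_finite us e0 ecap.
  rewrite rV => /(ge0_ler_powR (ltW r0)).
  rewrite -powRrM mulVf ?gt_eqF// powRr1; last first.
    by apply: sumr_ge0 => k _; rewrite divr_ge0 ?powR_ge0.
  by apply; rewrite nnegrE ?powR_ge0// mulr_ge0 ?powR_ge0.
have B0 : 0 <= B by exact: powR_ge0.
(* If the capacity were 0, every positive [e] would be admissible; the [e] chosen below makes the
   single term equal to [B + 1], beyond the bound [B]. *)
have cap_gt0 k : m k != 0 -> (0 < cap k)%E.
  move=> mk0; rewrite lt_def cap0 andbT; apply/eqP => cap_eq0.
  have mp0 : 0 < m k `^ p by rewrite powR_gt0// lt_def mk0 m0.
  have B1 : 0 < B + 1 by rewrite ltr_wpDl.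
  have eps0 : 0 < (m k `^ p / (B + 1)) `^ r^-1 by rewrite powR_gt0// divr_gt0.
  have := finite_bound [:: k] (fun=> (m k `^ p / (B + 1)) `^ r^-1) isT (fun=> eps0).
  rewrite big_seq1 -powRrM mulVf ?gt_eqF// powRr1 ?divr_ge0 ?powR_ge0 ?(ltW B1)//.
  have -> : m k `^ p / (m k `^ p / (B + 1)) = B + 1 by field; rewrite !gt_eqF.
  move=> H.
  suff : B + 1 <= B by rewrite gerDl ler10.
  by apply: H => j; rewrite inE => /eqP ->; rewrite cap_eq0 lte_fin.
(* The capacities are infima, so the bound applies to [lambda * cap k] for
   every [lambda > 1]. *)
have fin_cap_bound (s : seq int) : uniq s ->
    (forall k, k \in s -> m k != 0 /\ cap k \is a fin_num) ->
    \sum_(k <- s) m k `^ p / fine (cap k) `^ r <= B.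
  move=> us sP; set T := \sum_(k <- s) _.
  have T_le lambda : 1 < lambda -> T <= lambda `^ r * B.
    move=> l1; have l0 : 0 < lambda by exact: lt_trans l1.
    pose e k := if k \in s then lambda * fine (cap k) else 1.
    have cap_s k : k \in s -> 0 < fine (cap k).
      move=> ks; have [mk0 fin] := sP k ks.
      by rewrite -lte_fin fineK// cap_gt0.
    have e0 k : 0 < e k by rewrite /e; case: ifPn => // ks; rewrite mulr_gt0// cap_s.
    rewrite mulrC -ler_pdivrMr ?powR_gt0//; apply: le_trans (finite_bound s e us e0 _).
      rewrite /T mulr_suml big_seq [leRHS]big_seq; apply: ler_sum => k ks.
      rewrite /e ks powRM ?(ltW l0) ?(ltW (cap_s k ks))//.
      by rewrite invfM [(lambda `^ r)^-1 * _]mulrC mulrA.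
    move=> k ks; rewrite /e ks -(@fineK _ (cap k)); last by case: (sP k ks).
    by rewrite lte_fin ltr_pMl// cap_s.
  (* Take [lambda ^ r = 1 + eps / (B + 1)], so that [lambda ^ r * B <= B + eps]. *)
  apply/ler_addgt0Pr => eps eps0.
  have B1 : 0 < B + 1 by rewrite ltr_wpDl.
  have d0 : 0 < eps / (B + 1) by rewrite divr_gt0.
  have l1 : 1 < (1 + eps / (B + 1)) `^ r^-1.
    have {1}-> : 1 = 1 `^ r^-1 by rewrite powR1.
    apply: gt0_ltr_powR; rewrite ?invr_gt0 ?nnegrE ?ltrDl//.
    by rewrite addr_ge0// ltW.
  apply: le_trans (T_le _ l1) _; rewrite -powRrM mulVf ?gt_eqF// powRr1; last first.
    by rewrite addr_ge0// ltW.
  rewrite mulrDl mul1r lerD2l -mulrA ler_piMr ?(ltW eps0)// mulrC ler_pdivrMr// mul1r.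
  by rewrite lerDl.
have sum_le : (betaP_sum mu nu q O <= B%:E)%E.
  apply: ge_ereal_sup => _ [A [finA _] <-]; rewrite fsbig_finite//=.
  (* The discarded terms are 0: either the measure vanishes, or the capacity is [+oo] and its
     inverse power is 0. *)
  pose P k := (m k != 0) && (cap k \is a fin_num).
  rewrite (bigID P)/= [X in (_ + X)%E]big1 => [|k]; last first.
    rewrite negb_and negbK => /orP[/eqP mk0|].
      rewrite -(fineK_probability mu (mO k)) -/(m k) mk0 poweR_EFin powR0 ?mul0e//.
      by rewrite invr_neq0// gt_eqF.
    rewrite ge0_fin_numE//; rewrite -leNgt leye_eq => /eqP cap_y.
    by rewrite -/(cap k) cap_y poweRyr ?gt_eqF// invey mule0.
  rewrite adde0 -big_filter.
  set s := [seq k <- _ | P k].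
  have sP k : k \in s -> m k != 0 /\ cap k \is a fin_num.
    by rewrite mem_filter => /andP[/andP[]].
  apply: (@le_trans _ _ (\sum_(k <- s) m k `^ p / fine (cap k) `^ r)%:E); last first.
    by rewrite lee_fin fin_cap_bound// filter_uniq// finmap.fset_uniq.
  rewrite -sumEFin big_seq [leRHS]big_seq; apply: lee_sum => k ks.
  have [mk0 fin] := sP k ks.
  rewrite -(fineK_probability mu (mO k)) -/(m k) poweR_EFin.
  rewrite -/(cap k) -{1}(fineK fin) poweR_EFin.
  by rewrite inver gt_eqF -?EFinM// powR_gt0// -lte_fin fineK// cap_gt0.
have -> : (2 `^ q^-1 * C)%:E = (B%:E `^ r^-1)%E.
  by rewrite poweR_EFin -powRrM divff ?gt_eqF// powRr1// mulr_ge0 ?powR_ge0.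
rewrite rV; apply: gt0_ler_poweR => //; first by rewrite invr_ge0 ltW.
- rewrite in_itv/= leey andbT; apply: esum_ge0 => k _.
  by rewrite mule_ge0 ?inve_ge0 ?poweR_ge0.
- by rewrite in_itv/= lee_fin B0 leey.
Qed.

End PoincareToCapacity.

(** * From capacities to the Poincare inequality *)

Section Ramp.
Context {R : realType}.
Implicit Types t u a b : R.

Lemma continuous_pospart : continuous (fun t : R => Num.max t 0).
Proof. by move=> t; apply: continuous_max; [exact: cvg_id|exact: cvg_cst]. Qed.

Lemma is_derive_sqr_pospart (t : R) :
  is_derive t 1 (fun u : R => Num.max u 0 ^+ 2) (2 * Num.max t 0).
Proof.
have [t0|t0|->] := ltgtP t 0.
- apply: (@near_eq_is_derive _ _ _ (cst 0)); last first.
    by rewrite mulr0; exact: is_derive_cst.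
  near=> u; rewrite /= max_r ?expr0n//= ltW//.
  by near: u; exact: lt_nbhsl.
- apply: (@near_eq_is_derive _ _ _ (fun u => u ^+ 2)); last first.
    apply: is_derive_eq; rewrite /GRing.scale/=; ring.
  near=> u; rewrite /= max_l// ltW//.
  by near: u; exact: lt_nbhsr.
(* At 0 the square of the positive part is [u] times the positive part of [u], a continuous slope
   with value 0 there. *)
rewrite mulr0; apply/is_derive1_caratheodory.
exists (fun u => Num.max u 0); split.
- move=> z; rewrite maxxx expr0n/= !subr0 expr2.
  by case: (leP z 0) => // _; rewrite !mul0r.
- exact: continuous_pospart.
- by rewrite /= maxxx.
Unshelve. all: by end_near. Qed.

Lemma is_derive_sqr_pospart_affine (a b t : R) :
  is_derive t 1 (fun u : R => Num.max (a * u + b) 0 ^+ 2)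
    (2 * a * Num.max (a * t + b) 0).
Proof.
have h : is_derive t 1 (fun u : R => a * u + b) a.
  by apply: is_derive_eq; rewrite /GRing.scale/=; ring.
have := @is_derive1_comp _ (fun u : R => Num.max u 0 ^+ 2) (fun u : R => a * u + b) t _ _
  (is_derive_sqr_pospart _) h.
by rewrite mulrAC.
Qed.

(* A C^1 step from 0 at [t <= b / 2] to 1 at [t >= b], quadratic by pieces. *)
Definition ramp (b t : R) : R :=
  2 * Num.max (2 / b * t - 1) 0 ^+ 2
  - 4 * Num.max (2 / b * t - 3 / 2) 0 ^+ 2
  + 2 * Num.max (2 / b * t - 2) 0 ^+ 2.

Definition dramp (b t : R) : R :=
  2 / b * (4 * Num.max (2 / b * t - 1) 0
  - 8 * Num.max (2 / b * t - 3 / 2) 0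
  + 4 * Num.max (2 / b * t - 2) 0).

Lemma is_derive_ramp (b t : R) : is_derive t 1 (ramp b) (dramp b t).
Proof.
have d1 := is_derive_sqr_pospart_affine (2 / b) (- 1) t.
have d2 := is_derive_sqr_pospart_affine (2 / b) (- (3 / 2)) t.
have d3 := is_derive_sqr_pospart_affine (2 / b) (- 2) t.
have -> : ramp b = (2 \*: (fun u : R => Num.max (2 / b * u - 1) 0 ^+ 2)
   + (- 4) \*: (fun u : R => Num.max (2 / b * u - 3 / 2) 0 ^+ 2)
   + 2 \*: (fun u : R => Num.max (2 / b * u - 2) 0 ^+ 2)).
  by apply/funext => u; rewrite /ramp -mulNr.
by apply: is_derive_eq; rewrite /dramp /GRing.scale/=; ring.
Qed.

Lemma continuous_dramp (b : R) : continuous (dramp b).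
Proof.
have aff a c : continuous (fun t : R => a * Num.max (2 / b * t - c) 0).
  move=> t; apply: cvgM; first exact: cvg_cst.
  apply: (@continuous_comp _ _ _ (fun t : R => 2 / b * t - c) (fun t => Num.max t 0)).
    apply: cvgB; last exact: cvg_cst.
    by apply: cvgM; [exact: cvg_cst|exact: cvg_id].
  exact: continuous_pospart.
move=> t; apply: cvgM; first exact: cvg_cst.
by apply: cvgD; [apply: cvgB|]; exact: aff.
Qed.

Lemma rampE_le (b t : R) : 0 < b -> t <= b / 2 -> ramp b t = 0.
Proof.
move=> b0 tb; rewrite /ramp; set u := 2 / b * t.
have u1 : u <= 1 by rewrite /u mulrAC ler_pdivrMr// mul1r; lra.
by rewrite !max_r; try lra; rewrite expr0n; lra.
Qed.

Lemma rampE_ge (b t : R) : 0 < b -> b <= t -> ramp b t = 1.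
Proof.
move=> b0 tb; rewrite /ramp; set u := 2 / b * t.
have u1 : 2 <= u by rewrite /u mulrAC ler_pdivlMr//; lra.
by rewrite !max_l; try lra.
Qed.

Lemma ramp01 (b t : R) : 0 <= ramp b t <= 1.
Proof.
rewrite /ramp; set u := 2 / b * t; apply/andP.
case: (leP (u - 1) 0) => u1; case: (leP (u - 3 / 2) 0) => u2;
  case: (leP (u - 2) 0) => u3; split; try nra.
Qed.

Lemma dramp_eq0 (b t : R) : 0 < b -> ~ (b / 2 < t < b) -> dramp b t = 0.
Proof.
move=> b0 /negP; rewrite negb_and -!leNgt /dramp; set u := 2 / b * t.
case/orP => tb.
  have u1 : u <= 1 by rewrite /u mulrAC ler_pdivrMr// mul1r; lra.
  by rewrite !max_r; try lra.
have u1 : 2 <= u by rewrite /u mulrAC ler_pdivlMr//; lra.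
by rewrite !max_l; try lra.
Qed.

(** The slope is a tent supported between [b / 2] and [b] with peak [4 / b], whence the 16. *)
Lemma sqr_dramp_le (b t : R) : 0 < b -> b ^+ 2 * dramp b t ^+ 2 <= 16.
Proof.
move=> b0; rewrite -exprMn /dramp mulrA [b * _]mulrC divfK ?gt_eqF//.
set u := 2 / b * t.
set d := 2 * _; have /andP[d1 d2] : - 4 <= d <= 4.
  rewrite /d; case: (leP (u - 1) 0) => u1; case: (leP (u - 3 / 2) 0) => u2;
    case: (leP (u - 2) 0) => u3; apply/andP; split; lra.
nra.
Qed.

End Ramp.

(** * Dyadic levels *)

Section DyadicLevels.
Context {R : realType}.
Implicit Types (t : R) (j k : int).

(** The sign makes the levels decrease, so that their superlevel sets increase with [k], as the
    families in [betaP] must. *)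
Definition level k : R := 2 ^ (- k).

Lemma level_gt0 k : 0 < level k.
Proof. by rewrite exprz_gt0. Qed.

Lemma levelS k : level (k + 1) = level k / 2.
Proof. by rewrite /level opprD expfzDr// exprN1. Qed.

Lemma level_le j k : j <= k -> level k <= level j.
Proof. by move=> jk; rewrite /level ler_weXz2l// ?lerN2// ler1n. Qed.

Lemma level_interval_inj j k t : level j / 2 < t < level j ->
  level k / 2 < t < level k -> j = k.
Proof.
move=> /andP[jt tj] /andP[kt tk]; apply/eqP; rewrite eq_le !leNgt.
apply/andP; split; apply/negP => lt.
  have : level j <= level k / 2 by rewrite -levelS level_le// lezD1.
  by move=> /(le_lt_trans)/(_ kt) /lt_trans /(_ tj); rewrite ltxx.
have : level k <= level j / 2 by rewrite -levelS level_le// lezD1.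
by move=> /(le_lt_trans)/(_ jt) /lt_trans /(_ tk); rewrite ltxx.
Qed.

Lemma exists_level t : 0 < t -> exists k, level k < t <= 2 * level k.
Proof.
move=> t0; have l2 : 0 < ln 2 :> R by rewrite ln_gt0// ltr1n.
have levelE k : level k = expR ((- k)%:~R * ln 2).
  by rewrite /level -powR_intmul// /powR pnatr_eq0.
(* Since [t = 2 ^ (- y)], the bounds [floor y <= y < floor y + 1] locate [t] between two consecutive
   levels. *)
pose y := - ln t / ln 2; exists (Num.floor y + 1).
have tE : t = expR (- y * ln 2).
  by rewrite /y -mulNr opprK divfK ?gt_eqF// lnK.
apply/andP; split.
  rewrite levelE tE ltr_expR ltr_pM2r// rmorphN ltrN2/=.
  exact: floorD1_gt.
rewrite levelS mulrC divfK// levelE tE ler_expR ler_pM2r// rmorphN lerN2/=.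
exact: floor_le.
Qed.

(* At most one of the ramps has nonzero slope at a given [t]. *)
Lemma sum_sqr_dramp_le (s : seq int) t : uniq s ->
  \sum_(k <- s) level k ^+ 2 * dramp (level k) t ^+ 2 <= 16.
Proof.
move=> us; have [[k ks kt]|none] :=
    pselect (exists2 k, k \in s & level k / 2 < t < level k).
  rewrite (bigD1_seq k)//= big1 ?addr0 ?sqr_dramp_le ?level_gt0// => j jk.
  rewrite dramp_eq0 ?level_gt0 ?expr0n ?mulr0// => jt.
  by move: jk; rewrite (level_interval_inj jt kt) eqxx.
rewrite big_seq big1// => k ks; rewrite dramp_eq0 ?level_gt0 ?expr0n ?mulr0//.
by move=> kt; apply: none; exists k.
Qed.

End DyadicLevels.

(** * Superlevel sets and medians *)

Section LayerCake.
Context d (T : measurableType d) (R : realType) (P : probability T R).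

Lemma measurable_superlevel (f : T -> R) (t : R) : measurable_fun setT f ->
  measurable [set x | t < f x].
Proof.
move=> mf; rewrite -[X in measurable X]setTI.
exact: (measurable_fun_ltr (measurable_cst t) mf measurableT (I : measurable [set true])).
Qed.

Lemma nondecreasing_bigcup_le (A : nat -> set T) (c : \bar R) :
  (forall n, measurable (A n)) -> nondecreasing_seq A ->
  (forall n, (P (A n) <= c)%E) -> (P (\bigcup_n A n) <= c)%E.
Proof.
move=> mA ndA Ac; have cvgA : P \o A @ \oo --> P (\bigcup_n A n).
  by apply: nondecreasing_cvg_mu => //; exact: bigcupT_measurable.
rewrite -(cvg_lim _ cvgA)//; apply: lime_le; first by apply/cvg_ex; eexists; exact: cvgA.
by apply: nearW => k; exact: Ac.
Qed.

(** The infimum [m] of the [t >= 0] whose tail [f > t] has measure at most 1/2 works: [f > m] and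
    [f < m] are increasing unions of events at thresholds approaching [m], which inherit the bound
    1/2. *)
Lemma exists_median (f : T -> R) : measurable_fun setT f -> (forall x, 0 <= f x) ->
  exists m : R, [/\ 0 <= m, (P [set x | (m < f x)%R] <= (2^-1)%:E)%E &
                   (P [set x | (f x < m)%R] <= (2^-1)%:E)%E].
Proof.
move=> mf f0.
have mgt (t : R) : measurable [set x | t < f x] by exact: measurable_superlevel.
have mle (t : R) : measurable [set x | f x <= t].
  rewrite -[X in measurable X]setTI.
  exact: (measurable_fun_ler mf (measurable_cst t) measurableT (I : measurable [set true])).
have leE (t : R) : [set x | f x <= t] = ~` [set x | t < f x].
  by apply/seteqP; split => x /=; rewrite leNgt => /negP.
have P_le (t : R) : ((2^-1)%:E < P [set x | (t < f x)%R])%E ->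
    (P [set x | (f x <= t)%R] <= (2^-1)%:E)%E.
  rewrite leE probability_setC// -(@fineK _ (P [set x | (t < f x)%R])) ?fin_num_measure//.
  by rewrite -EFinB lee_fin lte_fin; lra.
pose S := [set t : R | 0 <= t /\ (P [set x | (t < f x)%R] <= (2^-1)%:E)%E].
have Slb : lbound S 0 by move=> t [].
(* Otherwise every event [f <= n] would have measure at most 1/2, although these events exhaust the
   space. *)
have S0 : S !=set0.
  apply: contrapT => /set0P/negP; rewrite negbK => /eqP S0.
  have : (P (\bigcup_n [set x | (f x <= n%:R)%R]) <= (2^-1)%:E)%E.
    apply: nondecreasing_bigcup_le => // [j k jk|k].
      by apply/subsetPset => x /= /le_trans; apply; rewrite ler_nat.
    apply: P_le; rewrite ltNge; apply/negP => Pk.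
    by have : S k%:R by []; rewrite S0.
  rewrite (_ : \bigcup_n _ = setT) ?probability_setT ?lee_fin; first lra.
  apply/seteqP; split => // x _; exists (Num.bound (f x)) => //=.
  by rewrite ltW// archi_boundP.
have hS : has_inf S by split => //; exists 0.
exists (inf S); split; first exact: lb_le_inf.
  rewrite (_ : [set x | _] = \bigcup_n [set x | inf S + n.+1%:R^-1 < f x]).
    apply: nondecreasing_bigcup_le => // [j k jk|k].
      apply/subsetPset => x /=; apply: le_lt_trans.
      by rewrite lerD2l lef_pV2 ?posrE// ler_nat.
    have [t [_ Pt] tlt] : exists2 t, S t & t < inf S + k.+1%:R^-1.
      by apply: inf_adherent => //; rewrite invr_gt0.
    apply: le_trans Pt; apply: le_measure; rewrite ?inE//.
    by move=> x /=; exact: lt_trans.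
  apply/seteqP; split => x /=; last first.
    by case=> k _ /=; apply: le_lt_trans; rewrite lerDl.
  move=> lt; have d0 : 0 < f x - inf S by rewrite subr_gt0.
  have [k kP] := ltr_add_invr lt.
  by exists k.
rewrite (_ : [set x | _] = \bigcup_n [set x | f x <= inf S - n.+1%:R^-1]).
  apply: nondecreasing_bigcup_le => // [j k jk|k].
    apply/subsetPset => x /= /le_trans; apply.
    by rewrite lerD2l lerN2 lef_pV2 ?posrE// ler_nat.
  (* A negative threshold has an empty sublevel set since [f >= 0]; a nonnegative one below [inf S]
     is not in [S], so its tail exceeds 1/2. *)
  have [t0|t0] := ltP (inf S - k.+1%:R^-1) 0.
    rewrite (_ : [set x | _] = set0) ?measure0 ?lee_fin ?invr_ge0//.
    by apply/seteqP; split => // x /= /le_lt_trans /(_ t0); rewrite ltNge f0.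
  apply: P_le; rewrite ltNge; apply/negP => Pk.
  have : inf S <= inf S - k.+1%:R^-1 by apply: ge_inf => //; exists 0.
  by rewrite lerDl oppr_ge0 leNgt invr_gt0 ltr0n.
apply/seteqP; split => x /=; last first.
  by case=> k _ /= /le_lt_trans; apply; rewrite ltrBlDr ltrDl.
move=> lt; have [k kP] := ltr_add_invr lt.
by exists k => //=; rewrite lerBrDr ltW.
Qed.

End LayerCake.

(** * Dyadic layer decomposition of an integral *)

Section LayerSum.
Context d (T : measurableType d) (R : realType) (P : probability T R).

(** Where [g > 0], some [k] has [level k < g <= 2 * level k], so the single layer [A k] already
    dominates [g ^ p]; the sum of all layers is then integrated termwise. *)
Lemma integral_pospart_powR_le (g : T -> R) (p B : R) :
  measurable_fun setT g -> 0 < p ->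
  (forall s : seq int, uniq s ->
     \sum_(k <- s) level k `^ p * fine (P [set x | (level k < g x)%R]) <= B) ->
  (\int[P]_x (Num.max (g x) 0 `^ p)%:E <= (2 `^ p * B)%:E)%E.
Proof.
move=> mg p0 sumB; pose O k := [set x | level k < g x].
have mO k : measurable (O k) by exact: measurable_superlevel.
pose A k x : R := (2 * level k) `^ p * \1_(O k) x.
have A0 k x : 0 <= A k x by rewrite mulr_ge0 ?powR_ge0.
have mA k : measurable_fun setT (A k).
  by apply: measurable_funM => //; exact: measurable_indic.
have intA k : (\int[P]_x (A k x)%:E = ((2 * level k) `^ p * fine (P (O k)))%:E)%E.
  under eq_integral do rewrite EFinM.
  rewrite ge0_integralZT ?powR_ge0// ?integral_indic ?setIT//.
  by rewrite EFinM fineK// fin_num_measure.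
(* Pairing [Posz n] with [Negz n] turns the sum over the integers into a series over the naturals,
   which can be integrated term by term. *)
pose u n x : \bar R := (A (Posz n) x + A (Negz n) x)%:E.
have u0 n x : (0 <= u n x)%E by rewrite lee_fin addr_ge0.
have intu n : (\int[P]_x (u n x) = ((2 * level (Posz n)) `^ p * fine (P (O (Posz n))) +
    (2 * level (Negz n)) `^ p * fine (P (O (Negz n))))%:E)%E.
  rewrite EFinD -!intA -ge0_integralD//.
  - by move=> x _; rewrite lee_fin.
  - exact/measurable_EFinP.
  - by move=> x _; rewrite lee_fin.
  - exact/measurable_EFinP.
apply: (@le_trans _ _ (\int[P]_x (\sum_(n <oo) u n x)%E)%E).
  apply: le_integralT => x; first by rewrite lee_fin powR_ge0.
  have [gx0|gx0] := leP (g x) 0.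
    by rewrite powR0 ?gt_eqF// nneseries_ge0.
  have [k /andP[gk kg]] := exists_level gx0.
  have Ak : g x `^ p <= A k x.
    rewrite /A indicE mem_set//= mulr1; apply: ge0_ler_powR => //.
    - exact: ltW.
    - by rewrite nnegrE ltW.
    - by rewrite nnegrE mulr_ge0// ltW// level_gt0.
  pose n := match k with Posz n => n | Negz n => n end.
  apply: (@le_trans _ _ (u n x)).
    rewrite lee_fin; apply: (le_trans Ak).
    by rewrite /n; case: (k) => j; rewrite ?lerDl ?lerDr.
  apply: le_trans (nneseries_lim_ge n.+1 _); last by [].
  by rewrite big_nat_recr//= leeDr// sume_ge0.
rewrite integral_nneseries//; last first.
  move=> n; apply/measurable_EFinP; exact: measurable_funD.
apply: lime_le; first by apply: is_cvg_nneseries => n _ _; rewrite integral_ge0.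
apply: nearW => N.
pose s := [seq Posz n | n <- iota 0 N] ++ [seq Negz n | n <- iota 0 N].
have us : uniq s.
  rewrite cat_uniq !map_inj_uniq ?iota_uniq//=; last 2 first.
  - by move=> i j [].
  - by move=> i j [].
  by rewrite andbT; apply/hasPn => _ /mapP[j _ ->]; apply/mapP => -[].
rewrite (eq_bigr _ (fun n _ => intu n)) sumEFin lee_fin.
have -> : \sum_(0 <= n < N) ((2 * level (Posz n)) `^ p * fine (P (O (Posz n))) +
      (2 * level (Negz n)) `^ p * fine (P (O (Negz n)))) =
    2 `^ p * \sum_(k <- s) level k `^ p * fine (P (O k)).
  rewrite /s big_cat !big_map/= -big_split/= mulr_sumr /index_iota subn0.
  apply: eq_bigr => n _; rewrite !powRM ?(ltW (level_gt0 _))//.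
  by rewrite mulrDr !mulrA.
by rewrite ler_wpM2l ?powR_ge0// sumB.
Qed.

End LayerSum.

(** * Capacity estimates and the resulting variance bound *)

Section CapacityToPoincare.
Context {R : realType} {n : nat} (M : riemannianManifold R n).
Variables (mu : probability (borel M) R) (nu : {measure set (borel M) -> \bar R}).
Variable q : R.
Hypothesis q_gt0 : 0 < q.
Hypothesis q_lt1 : q < 1.

Lemma energy_ramp (g : M -> R) (b : R) : C1 g ->
  energy nu (ramp b \o g) =
  (\int[nu]_x (dramp b (g x) ^+ 2 * grad_norm2 g (x : M))%:E)%E.
Proof.
move=> g1; apply: eq_integral => x _; congr EFin; apply: grad_norm2Z.
by apply: diff_coord_comp => //; exact: is_derive_ramp.
Qed.

Lemma betaP_sum_ge0 (O : int -> set (borel M)) : (0 <= betaP_sum mu nu q O)%E.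
Proof.
by apply: esum_ge0 => k _; rewrite mule_ge0 ?inve_ge0 ?poweR_ge0.
Qed.

Lemma finite_sum_le_betaP_sum (O : int -> set (borel M)) (s : seq int) : uniq s ->
  (\sum_(k <- s) (mu (O k) `^ (1 - q)^-1 /
     capacity nu (O k) (O (k + 1)%R) `^ (q / (1 - q))) <= betaP_sum mu nu q O)%E.
Proof.
move=> us; apply: ereal_sup_ubound => /=; exists [set` s].
  by split => //; exact: finite_seq.
by rewrite -fsbig_seq.
Qed.

(** In the constant 64, the factor 16 comes from the slopes of the ramps and the factor 4 from the
    dyadic comparison, as [2 ^ (2q) = 4 ^ q]. *)
Lemma integral_pospart_le_betaP (g : M -> R) (E b : R) : C1 g ->
  (mu [set x : borel M | (0 < g x)%R] <= (2^-1)%:E)%E ->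
  (energy nu g <= E%:E)%E -> (betaP mu nu q <= b%:E)%E ->
  (\int[mu]_x (Num.max (g x) 0 `^ (2 * q))%:E <= ((64 * E * b) `^ q)%:E)%E.
Proof.
move=> g1 mug gE betab.
have q10 : 0 < 1 - q by rewrite subr_gt0.
have E0 : 0 <= E by rewrite -lee_fin; apply: le_trans gE; exact: energy_ge0.
have mg := C1_measurable g1.
have mgt (t : R) : measurable [set x : borel M | t < g x].
  exact: measurable_superlevel.
pose O k := [set x : borel M | level k < g x].
pose cap k := capacity nu (O k) (O (k + 1)).
have OS k : O k `<=` O (k + 1).
  by move=> x; apply: le_lt_trans; apply: level_le; rewrite lerDl.
set p := (1 - q)^-1; set r := q / (1 - q); set S := betaP_sum mu nu q O.
have r0 : 0 < r by rewrite divr_gt0.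
(* The sets [O k] form an admissible family inside [g > 0], a set of measure at most 1/2. *)
have Sb : (S `^ r^-1 <= b%:E)%E.
  apply: le_trans betab; apply: ereal_sup_ubound; exists [set x : borel M | 0 < g x], O.
  split => // [k|k|]; first exact: mgt.
    by split => // x; apply: lt_trans; exact: level_gt0.
  by rewrite /r invf_div.
have b0 : 0 <= b by rewrite -lee_fin; apply: le_trans Sb; exact: poweR_ge0.
have {}Sb : (S <= (b `^ r)%:E)%E.
  rewrite -[leLHS](@poweRe1 R) ?betaP_sum_ge0// -(mulVf (lt0r_neq0 r0)) poweRrM.
  rewrite -poweR_EFin; apply: gt0_ler_poweR => //; first exact: ltW.
  - by rewrite in_itv/= poweR_ge0 leey.
  - by rewrite in_itv/= lee_fin b0 leey.
have ramp1 k : C1 (ramp (level k) \o g).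
  apply: (@C1_comp _ _ _ _ _ (dramp (level k))) g1; last exact: continuous_dramp.
  exact: is_derive_ramp.
(* The ramp is 1 where [g > level k] and 0 where [g <= level k / 2 = level (k + 1)], hence a
   competitor for the capacity. *)
have cap_le k : (cap k <= energy nu (ramp (level k) \o g))%E.
  apply: ereal_inf_lbound; exists (ramp (level k) \o g); last by [].
  split; first exact: ramp1.
  move=> x.
  rewrite !indicE /=; apply/andP; split.
    have [/set_mem xO|_] := boolP (x \in O k); last by have /andP[] := ramp01 (level k) (g x).
    by rewrite rampE_ge ?level_gt0// ltW.
  have [_|/negP xO] := boolP (x \in O (k + 1)); first by have /andP[] := ramp01 (level k) (g x).
  rewrite rampE_le ?level_gt0// -levelS leNgt; apply/negP => lt.
  by apply: xO; rewrite inE.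
have dg0 k (x : M) : 0 <= dramp (level k) (g x) ^+ 2 * grad_norm2 g x.
  by rewrite mulr_ge0 ?sqr_ge0 ?grad_norm2_ge0.
have sum_energy (s : seq int) : uniq s ->
    (\sum_(k <- s) (level k ^+ 2)%:E * energy nu (ramp (level k) \o g) <= (16 * E)%:E)%E.
  move=> us; rewrite (eq_bigr (fun k => \int[nu]_x
      (level k ^+ 2 * (dramp (level k) (g x) ^+ 2 * grad_norm2 g (x : M)))%:E)%E); last first.
    move=> k _; rewrite energy_ramp// -ge0_integralZT ?sqr_ge0//.
    by move=> x; rewrite lee_fin.
  apply: le_trans (integral_super_sum _ _ _) _.
    by move=> k x; rewrite lee_fin mulr_ge0 ?sqr_ge0.
  apply: (@le_trans _ _ (\int[nu]_x (16%:E * (grad_norm2 g (x : M))%:E))%E).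
    apply: le_integralT => x.
      by apply: sume_ge0 => k _; rewrite lee_fin mulr_ge0 ?sqr_ge0.
    rewrite sumEFin -EFinM lee_fin.
    under eq_bigr do rewrite mulrA.
    by rewrite -mulr_suml ler_wpM2r ?grad_norm2_ge0// sum_sqr_dramp_le.
  rewrite ge0_integralZT//; last by move=> x; rewrite lee_fin grad_norm2_ge0.
  by rewrite EFinM lee_wpmul2l// lee_fin.
have cap0 k : (0 <= cap k)%E by exact: capacity_ge0.
have cap_fin k : cap k \is a fin_num.
  rewrite ge0_fin_numE//; apply: le_lt_trans (cap_le k) _.
  have := sum_energy [:: k] isT; rewrite big_seq1 => le16.
  have l0 : 0 < (level k : R) ^+ 2 by rewrite exprn_gt0// level_gt0.
  have : ((level k ^+ 2)%:E * energy nu (ramp (level k) \o g) < +oo)%E.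
    by apply: le_lt_trans le16 _; rewrite ltry.
  have := energy_ge0 nu (ramp (level k) \o g).
  by case: (energy nu _) => [e _ _|_|//]; rewrite ?ltry// gt0_muley ?lte_fin.
pose m k := fine (mu (O k)); pose c k := fine (cap k).
have m0 k : 0 <= m k by rewrite fine_ge0.
have c0 k : 0 <= c k by rewrite fine_ge0.
have muE k : mu (O k) = (m k)%:E by rewrite -(fineK_probability mu (mgt _)).
have capE k : cap k = (c k)%:E by rewrite fineK.
have sum_a (s : seq int) : uniq s -> \sum_(k <- s) level k ^+ 2 * c k <= 16 * E.
  move=> us; rewrite -lee_fin; apply: le_trans (sum_energy s us).
  rewrite -sumEFin; apply: lee_sum => k _.
  by rewrite EFinM lee_wpmul2l ?lee_fin ?sqr_ge0// -capE.
(* Only an inequality: at zero capacity the real inverse is 0, the extended one [+oo]. *)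
have term_le k : ((m k `^ p / c k `^ r)%:E <=
    mu (O k) `^ p / capacity nu (O k) (O (k + 1)%R) `^ r)%E.
  rewrite -/(cap k) muE capE !poweR_EFin inver.
  case: ifPn => [/eqP ->|_]; last by rewrite EFinM.
  by rewrite invr0 mulr0 mule_ge0// ?lee_fin ?powR_ge0.
have sum_b (s : seq int) : uniq s -> \sum_(k <- s) m k `^ p / c k `^ r <= b `^ r.
  move=> us; rewrite -lee_fin; apply: le_trans Sb.
  apply: le_trans (finite_sum_le_betaP_sum O us).
  by rewrite -sumEFin; apply: lee_sum => k _; exact: term_le.
(* A set of positive measure and zero capacity would contribute [+oo] to [S], which is finite. *)
have m_eq0 k : c k = 0 -> m k = 0.
  move=> ck0; apply/eqP/negPn/negP => mk0.
  have : (mu (O k) `^ p / capacity nu (O k) (O (k + 1)%R) `^ r <= (b `^ r)%:E)%E.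
    apply: le_trans Sb; apply: le_trans (@finite_sum_le_betaP_sum O [:: k] isT).
    by rewrite big_seq1.
  rewrite -/(cap k) muE capE ck0 poweR_EFin poweR_EFin powR0 ?gt_eqF// inve0.
  by rewrite gt0_muley ?lte_fin ?powR_gt0// lt_def mk0 m0.
(* Hoelder is applied with weights [q] and [1 - q]. As [p * (1 - q) = 1] and [r * (1 - q) = q], the
   powers of [c k] cancel, leaving [level k ^ (2q) * m k]. *)
have key (s : seq int) : uniq s ->
    \sum_(k <- s) level k `^ (2 * q) * m k <= (16 * E * b) `^ q.
  move=> us.
  have := @finite_hoelder _ _ s (fun k => level k ^+ 2 * c k)
    (fun k => m k `^ p / c k `^ r) _ _ q q_gt0 q_lt1 _ _ (sum_a s us) (sum_b s us).
  rewrite -powRrM divfK ?gt_eqF// -powRM ?mulr_ge0// => H.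
  apply: le_trans (H _ _); last 2 first.
  - by move=> k; rewrite mulr_ge0 ?sqr_ge0.
  - by move=> k; rewrite divr_ge0 ?powR_ge0.
  apply: ler_sum => k _; have l0 := @level_gt0 R k.
  have [ck0|ck0] := eqVneq (c k) 0.
    by rewrite (m_eq0 _ ck0) !mulr0 mulr_ge0 ?powR_ge0.
  have cr0 : c k `^ q != 0 by rewrite powR_eq0 negb_and ck0.
  rewrite powRM ?sqr_ge0// (@powRM _ _ (_^-1)) ?powR_ge0 ?invr_ge0 ?powR_ge0//.
  rewrite -powRrM mulVf ?gt_eqF// powRr1// -powR_inv1 ?powR_ge0//.
  rewrite -!powRrM mulN1r mulrN divfK ?gt_eqF// powRN.
  rewrite -(powR_mulrn 2 (ltW l0)) -powRrM.
  by rewrite -mulrA [c k `^ q * _]mulrC divfK.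
apply: le_trans (integral_pospart_powR_le mg _ key) _; first by rewrite mulr_gt0.
rewrite lee_fin powRrM -powRM ?powR_ge0 ?mulr_ge0// -[X in 2 `^ X]/(2%:R) powR_mulrn//.
by rewrite (_ : 2 ^+ 2 * (16 * E * b) = 64 * E * b)//; ring.
Qed.

Lemma variance_powR_le_betaP (f : M -> R) (E b : R) : C1 f -> (forall x, 0 <= f x) ->
  (energy nu f <= E%:E)%E -> (betaP mu nu q <= b%:E)%E ->
  ('V_mu[fun x : borel M => (f x `^ q)%R] <= (2 * (64 * E * b) `^ q)%:E)%E.
Proof.
move=> f1 f0 fE betab.
have [m [m0 mgt mlt]] := exists_median mu (C1_measurable f1) f0.
(* Only [a = 1] and [a = - 1] are used, giving [f - m] and [m - f]; since [a ^ 2 = 1], both have the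
   energy of [f]. *)
pose g a x := a * f x + - (a * m).
have g1 a : C1 (g a) by exact: (C1_addZ a f1 (@C1_cst _ _ M _)).
have gE a : a ^+ 2 = 1 -> (energy nu (g a) <= E%:E)%E.
  move=> a2; apply: le_trans fE; rewrite le_eqVlt; apply/orP; left; apply/eqP.
  apply: eq_integral => x _; congr EFin.
  rewrite (@grad_norm2Z _ _ _ f _ a) ?a2 ?mul1r//.
  by rewrite (diff_coord_addZ a x f1 (@C1_cst _ _ M _)) diff_coord_cst addr0.
have mpos a : measurable_fun setT (fun x : borel M => Num.max (g a x) 0 `^ (2 * q)).
  apply: measurableT_comp (measurable_powR _) _.
  exact: measurable_maxr (C1_measurable (g1 a)) (measurable_cst _).
have up : (\int[mu]_x (Num.max (g 1 x) 0 `^ (2 * q))%:E <= ((64 * E * b) `^ q)%:E)%E.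
  apply: (integral_pospart_le_betaP (g1 1) _ (gE 1 (expr1n _ 2)) betab).
  rewrite (_ : [set _ | _] = [set x | m < f x])//.
  by apply/seteqP; split => x /=; rewrite /g !mul1r subr_gt0.
have down : (\int[mu]_x (Num.max (g (- 1) x) 0 `^ (2 * q))%:E <= ((64 * E * b) `^ q)%:E)%E.
  have sqN1 : (- 1) ^+ 2 = 1 :> R by rewrite sqrrN expr1n.
  apply: (integral_pospart_le_betaP (g1 (- 1)) _ (gE _ sqN1) betab).
  rewrite (_ : [set _ | _] = [set x | f x < m])//.
  by apply/seteqP; split => x /=; rewrite /g !mulN1r opprK addrC subr_gt0.
have mfq : measurable_fun setT (fun x : borel M => f x `^ q).
  exact: measurableT_comp (measurable_powR _) (C1_measurable f1).
apply: le_trans (variance_le_sqr _ (m `^ q) mfq) _.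
rewrite mulr_natl mulr2n EFinD; apply: le_trans (leeD up down).
rewrite -ge0_integralD//; last 4 first.
- by move=> x _; rewrite lee_fin powR_ge0.
- exact/measurable_EFinP.
- by move=> x _; rewrite lee_fin powR_ge0.
- exact/measurable_EFinP.
apply: le_integralT => x; first by rewrite lee_fin sqr_ge0.
rewrite -EFinD lee_fin /g !mul1r !mulN1r opprK [- f x + m]addrC.
by apply: sqr_powRB_le => //; exact: ltW.
Qed.

(** The family of empty sets is admissible, so the supremum is not over an empty set. *)
Lemma betaP_ge0 : (0 <= betaP mu nu q)%E.
Proof.
apply: (@le_trans _ _ (betaP_sum mu nu q (fun=> set0) `^ ((1 - q) / q))%E).
  exact: poweR_ge0.
apply: ereal_sup_ubound; exists set0, (fun=> set0); split => //; last by move=> k; split.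
by rewrite measure0 lee_fin invr_ge0.
Qed.

Lemma betaP_poincare : (betaP mu nu q < +oo)%E ->
  Lq_poincare mu nu q (64 * 2 `^ q^-1 * fine (betaP mu nu q)).
Proof.
move=> betay.
have betaE : betaP mu nu q = (fine (betaP mu nu q))%:E.
  by rewrite fineK// ge0_fin_numE// betaP_ge0.
set b := fine _ in betaE *; have b0 : 0 <= b by exact/fine_ge0/betaP_ge0.
split => [|f f1 f0 fy]; first by rewrite !mulr_ge0 ?powR_ge0.
have fE : energy nu f = (fine (energy nu f))%:E.
  by rewrite fineK// ge0_fin_numE// energy_ge0.
set E := fine _ in fE; have E0 : 0 <= E by exact/fine_ge0/energy_ge0.
have V := @variance_powR_le_betaP f E b f1 f0.
rewrite fE betaE !lexx in V; have {}V := V isT isT.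
have qV0 : 0 <= q^-1 by rewrite invr_ge0 ltW.
(* The power [1 / q] of the variance bound is exactly [2 ^ (1 / q) * 64 * E * b]. *)
apply: (@le_trans _ _ ((2 * (64 * E * b) `^ q)%:E `^ q^-1)%E).
  apply: gt0_ler_poweR => //.
  - by rewrite in_itv/= variance_ge0 leey.
  - by rewrite in_itv/= lee_fin mulr_ge0 ?powR_ge0// leey.
rewrite fE poweR_EFin lee_fin powRM ?powR_ge0// -powRrM divff ?gt_eqF// powRr1.
  by rewrite le_eqVlt; apply/orP; left; apply/eqP; ring.
by rewrite !mulr_ge0.
Qed.

End CapacityToPoincare.

Theorem theorem2p3 (R : realType) (q : R) (hq0 : 0 < q) (hq1 : q < 1) :
  (2^-1 <= q ->
   forall (n : nat) (M : riemannianManifold R n)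
     (mu : probability (borel M) R) (nu : {measure set (borel M) -> \bar R})
     (CP : R),
     Lq_poincare mu nu q CP -> (betaP mu nu q <= (2 `^ q^-1 * CP)%:E)%E) /\
  (exists kappaP : R,
   forall (n : nat) (M : riemannianManifold R n)
     (mu : probability (borel M) R) (nu : {measure set (borel M) -> \bar R}),
     (betaP mu nu q < +oo)%E ->
     exists CP : R,
       Lq_poincare mu nu q CP /\ (CP%:E <= kappaP%:E * betaP mu nu q)%E).
Proof.
split => [q_ge_half n M mu nu CP poinc|].
  apply: ge_ereal_sup => _ [W [U [mW muW mU US ->]]].
  apply: (poincare_betaP_sum hq0 hq1 q_ge_half poinc mW muW mU) => k.
    by case: (US k).
  by have [U1 U2] := US k; exact: subset_trans U2.
exists (64 * 2 `^ q^-1); move=> n M mu nu betay.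
exists (64 * 2 `^ q^-1 * fine (betaP mu nu q)); split.
  exact: betaP_poincare.
by rewrite EFinM fineK// ge0_fin_numE// betaP_ge0.
Qed.
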